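(* A process $X$ is a quasi-martingale if and only if it decomposes into the sum $$X=M+B$$ of a martingale $M$ and a quasi-potential $B$. The decomposition is then unique (up to modification). Moreover, if $X$, $M$ and $B$ are as in this decomposition, then: (i) $X$ is a supermartingale if and only if $B$ is a potential; and $X$ is a positive supermartingale if and only if $B$ is a potential and $M$ is positive. (ii) Let $x\in\mathscr M^{loc}$ correspond to $X$, and let $(\delta_x(n))_{n\in\mathbb N}$ and $(\delta^x(n))_{n\in\mathbb N}$ be monotonic sequences in $\Delta$ (decreasing and increasing respectively) such that $\lim_n|x|(]\delta_x(n),\delta^x(n)])=\sup_{\delta,\delta'\in\Delta}|x|(]\delta,\delta'])$. If for any $\delta\in\Delta$ there is an integer $n$ such that $\delta^x(n)\ge\delta$, then $M$ is uniformly integrable if and only if $\{X_{\delta^x(n)}:n=1,2,\ldots\}$ is uniformly integrable.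
   Context: Setting. $(\Omega,\mathscr F,P)$ is a probability space, $P(\cdot)$ also denotes expectation and $P(\cdot|\mathscr G)$ conditional expectation. $\Delta$ is a linearly ordered set and $(\mathscr F_\delta:\delta\in\Delta)$ an increasing family of sub $\sigma$-algebras of $\mathscr F$ (no right continuity assumed); all $\sigma$-algebras include the corresponding $P$-null sets. $\bar\Omega=\Omega\times\Delta$; $\bar{\mathscr F}$ is the augmentation of $\mathscr F\otimes 2^\Delta$ with respect to sets with $P$-null projection on $\Omega$. $\mathfrak B(\cdot)$ denotes bounded measurable functions. $]\delta_1,\delta_2]=\{\delta\in\Delta:\delta_1<\delta\le\delta_2\}$ (possibly empty), also identified with $\Omega\times]\delta_1,\delta_2]$. All processes $X=(X_\delta:\delta\in\Delta)$ are adapted. Two processes are considered equal (up to modification) if $P(X_\delta=Y_\delta)=1$ for all $\delta$. $\mathscr D$ is the collection of finite subsets $d=\{\delta_1\le\ldots\le\delta_{N+1}\}$ of $\Delta$, directed by inclusion. The $d$-variation of $X$ is $V^d(X)=\sum_{n=1}^N|X_{\delta_n}-P(X_{\delta_{n+1}}|\mathscr F_{\delta_n})|$. $X$ is a quasi-martingale if $\|X\|_{\mathcal Q}=\sup\{P(V^d(X)):d\in\mathscr D\}<\infty$ (integrability not required). A quasi-potential is a quasi-martingale $X$ for which there is a sequence $(\delta_n)_{n\in\mathbb N}$ in $\Delta$ such that $\lim_nP(|X_{\bar\delta_n}|)=0$ for every sequence $(\bar\delta_n)$ in $\Delta$ with $\bar\delta_n\ge\delta_n$ for all $n$. A potential is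 a process that is both a quasi-potential and a positive supermartingale. Correspondence $X\leftrightarrow x$. For $d\in\mathscr D$, $\mathscr P^d=\{\bigcup_{n=1}^N F_n\times]\delta_n,\delta_{n+1}]:F_n\in\mathscr F_{\delta_n}\}$; $\mathfrak B(\mathscr P^d)$ consists of $h=\sum_{n}h_n\mathbf 1_{]\delta_n,\delta_{n+1}]}$ with $h_n\in\mathfrak B(\mathscr F_{\delta_n})$; and $P\int h\,dX=\sum_nP\big(h_n(P(X_{\delta_{n+1}}|\mathscr F_{\delta_n})-X_{\delta_n})\big)$, which is the expectation of $\sum_nh_n(X_{\delta_{n+1}}-X_{\delta_n})$ if $X$ is integrable. $\mathscr P^d$ also denotes the operator $\mathscr P^d(U)=\sum_{n=1}^NP(U_{\delta_{n+1}}|\mathscr F_{\delta_n})\mathbf 1_{]\delta_n,\delta_{n+1}]}$ from $\mathfrak B(\bar{\mathscr F})$ to $\mathfrak B(\mathscr P^d)$. $\mathrm{LIM}_{d\in\mathscr D}$ is a fixed Banach limit on bounded nets indexed by $\mathscr D$ (a positive linear functional extending the ordinary limit). $ba(\bar{\mathscr F})$ is the space of bounded finitely additive measures on $\bar{\mathscr F}$; $\mathscr M^{loc}$ is the set of $x\in ba(\bar{\mathscr F})$ whose restriction to $\mathscr P^d$ is countably additive for each $d\in\mathscr D$; $|x|$ is the total variation measure of $x$. The quasi-martingale $X$ corresponds to $x\in\mathscr M^{loc}$ defined by $x(f)=-\mathrm{LIM}_{d\in\mathscr D}\,P\int\mathscr P^d(f)\,dX$ for all $f\in\mathfrak B(\bar{\mathscr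 F})$. *)

(* Defs.v *)
From HB Require Import structures.
From mathcomp Require Import all_boot all_order all_algebra finmap.
From mathcomp Require Import all_classical all_reals all_analysis.
From mathcomp Require summability.

Set Implicit Arguments.
Unset Strict Implicit.
Unset Printing Implicit Defensive.

Import Order.TTheory GRing.Theory Num.Theory.
Import numFieldNormedType.Exports.

Local Open Scope classical_set_scope.
Local Open Scope ring_scope.

Section conditional_expectation.
Context {R : realType} {dT : measure_display} {T : measurableType dT}.
Variable P : probability T R.
Implicit Types (G : set_system T) (Y Z : T -> R).

(* sigma(f) is included in the sigma-algebra G. *)
Definition measurable_wrt {U : Type} (G : set_system U) (f : U -> R) :=
  preimage_set_system setT f measurable `<=` G.

(* Z is a (finite) version of P(Y|G), for Y >= 0 not necessarily integrable;
   the integrals below are allowed to be infinite. *)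
Definition is_condexp_nneg G Y Z :=
  [/\ measurable_wrt G Z, (forall w, 0 <= Z w) &
      forall A, G A ->
        (\int[P]_(w in A) (Z w)%:E = \int[P]_(w in A) (Y w)%:E)%E].

(* Conditional expectation in the generalized sense,
   P(Y|G) = P(Y^+|G) - P(Y^-|G) with both terms finite. Y need not be
   integrable: for instance P(Y|G) = Y for every G-measurable Y. For integrable
   Y this is the usual conditional expectation. *)
Definition is_condexp G Y Z :=
  exists Zp Zm, [/\ is_condexp_nneg G Y^\+ Zp, is_condexp_nneg G Y^\- Zm &
                    Z = Zp \- Zm].

Definition has_condexp G Y := exists Z, is_condexp G Y Z.

(* A fixed version of P(Y|G); meaningful only if has_condexp G Y. *)
Definition condexp G Y : T -> R := xget (cst 0) [set Z | is_condexp G Y Z].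

Definition uniformly_integrable {I : Type} (Y : I -> T -> R) :=
  ereal_sup (range (fun i : I =>
    (\int[P]_(w in [set w | (c <= `|Y i w|)%R]) (`|Y i w|%R)%:E)%E))
    @[c --> +oo] --> 0%E.

End conditional_expectation.

Section processes.
Context {R : realType} {dT : measure_display} {T : measurableType dT}.
Variable P : probability T R.
Context {dD : Order.disp_t} {Delta : orderType dD}.
Variable F : Delta -> set_system T.

(* Increasing family of sub-sigma-algebras of the (P-complete) ambient one,
   each containing the P-null sets; no right continuity. *)
Definition complete_filtration :=
  [/\ measure_is_complete P,
      (forall t, [/\ sigma_algebra setT (F t), F t `<=` measurable &
                     P.-negligible `<=` F t]) &
      (forall s t, (s <= t)%O -> F s `<=` F t)].

Implicit Types X Y M B : Delta -> T -> R.

Definition adapted X := forall t, measurable_wrt (F t) (X t).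

Definition modification X Y := forall t, {ae P, forall w, X t w = Y t w}.

(* The pairs (delta_n, delta_(n+1)), n = 1..N, of consecutive elements of
   d = {delta_1 < ... < delta_(N+1)}. *)
Definition steps (d : {fset Delta}) : seq (Delta * Delta) :=
  let s := sort <=%O (enum_fset d) in zip s (behead s).

Definition dvariation (d : {fset Delta}) X (w : T) : R :=
  \sum_(p <- steps d) `|X p.1 w - condexp P (F p.1) (X p.2) w|.

Definition qnorm X : \bar R :=
  ereal_sup (range (fun d : {fset Delta} => 'E_P[dvariation d X]%E)).

Definition condexps_exist X :=
  forall s t, (s <= t)%O -> has_condexp P (F s) (X t).

(* X itself is not required to be integrable: only the conditional expectations
   occurring in the variation have to exist. *)
Definition quasi_martingale X :=
  [/\ adapted X, condexps_exist X & (qnorm X < +oo)%E].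

Definition martingale M :=
  [/\ adapted M, condexps_exist M &
      forall s t, (s <= t)%O ->
        {ae P, forall w, condexp P (F s) (M t) w = M s w}].

Definition supermartingale X :=
  [/\ adapted X, condexps_exist X &
      forall s t, (s <= t)%O ->
        {ae P, forall w, condexp P (F s) (X t) w <= X s w}].

Definition positive_process X := forall t, {ae P, forall w, 0 <= X t w}.

Definition positive_supermartingale X := supermartingale X /\ positive_process X.

Definition quasi_potential X :=
  quasi_martingale X /\
  exists u : nat -> Delta, forall v : nat -> Delta,
    (forall n, (u n <= v n)%O) ->
    'E_P[fun w => `|X (v n) w|%R]%E @[n --> \oo] --> 0%E.

Definition potential X := quasi_potential X /\ positive_supermartingale X.

Definition riesz_decomposition X M B :=
  [/\ martingale M, quasi_potential B &
      modification X (fun t w => M t w + B t w)].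

End processes.

Section associated_measure.
Context {R : realType} {dT : measure_display} {T : measurableType dT}.
Variable P : probability T R.
Context {dD : Order.disp_t} {Delta : orderType dD}.
Variable F : Delta -> set_system T.

(* The interval ]s, t] seen as a subset of Omega x Delta; empty unless s < t. *)
Definition strip (s t : Delta) : set (T * Delta) := setT `*` [set` `]s, t]%O].

(* The product of the ambient sigma-algebra with the power set of Delta,
   augmented with the sets whose projection on Omega is P-null. *)
Definition Fbar : set_system (T * Delta) :=
  <<s [set A `*` B | A in measurable & B in setT] `|`
      [set N | P.-negligible (fst @` N)] >>.

(* P^d; the base of the step p is F_(p.1)-measurable. *)
Definition elementary (d : {fset Delta}) : set_system (T * Delta) :=
  [set A | exists S : Delta * Delta -> set T,
     (forall p, p \in steps d -> F p.1 (S p)) /\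
     A = \bigcup_(p in [set` steps d]) (S p `*` [set` `]p.1, p.2]%O])].

(* The operator P^d, U |-> sum_n P(U_(delta_(n+1))|F_(delta_n)) 1_]delta_n, delta_(n+1)]. *)
Definition predictable_proj (d : {fset Delta}) (U : T * Delta -> R) :
    T * Delta -> R :=
  fun z => \sum_(p <- steps d)
    condexp P (F p.1) (fun w => U (w, p.2)) z.1 *
    \1_(strip p.1 p.2) z.

(* P int h dX for h = sum_n h_n 1_]delta_n, delta_(n+1)]; h_n is recovered as
   the section of h at delta_(n+1). *)
Definition elementary_integral (d : {fset Delta}) (h : T * Delta -> R)
    (X : Delta -> T -> R) : R :=
  \sum_(p <- steps d)
    fine 'E_P[fun w => (h (w, p.2) *
                        (condexp P (F p.1) (X p.2) w - X p.1 w))%R]%E.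

(* Set functions x : set (T * Delta) -> R are only relevant on Fbar. *)
Definition ba (x : set (T * Delta) -> R) :=
  (forall A B, Fbar A -> Fbar B -> A `&` B = set0 ->
     x (A `|` B) = x A + x B) /\
  (exists C : R, forall A, Fbar A -> `|x A| <= C).

Definition ba_variation (x : set (T * Delta) -> R) (A : set (T * Delta)) :
    \bar R :=
  ereal_sup [set v : \bar R |
    exists (n : nat) (A_ : nat -> set (T * Delta)),
      [/\ (forall i, (i < n)%N -> Fbar (A_ i)), trivIset `I_n A_,
          \bigcup_(i < n) A_ i = A &
          v = (\sum_(i < n) `|x (A_ i)|)%:E]].

(* I is the integral of the bounded function f with respect to x: f is a
   uniform limit of Fbar-simple functions whose integrals converge to I. *)
Definition is_ba_integral (x : set (T * Delta) -> R) (f : T * Delta -> R)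
    (I : R) :=
  forall e : R, 0 < e ->
    exists (n : nat) (c : nat -> R) (A_ : nat -> set (T * Delta)),
      [/\ (forall i, (i < n)%N -> Fbar (A_ i)),
          (forall z, `|f z - \sum_(i < n) c i * \1_(A_ i) z| <= e) &
          `|I - \sum_(i < n) c i * x (A_ i)| <= e].

Definition Mloc (x : set (T * Delta) -> R) :=
  ba x /\
  forall (d : {fset Delta}) (A_ : nat -> set (T * Delta)),
    (forall k, elementary d (A_ k)) -> trivIset setT A_ ->
    (\sum_(0 <= k < n) x (A_ k)) @[n --> \oo] --> x (\bigcup_k A_ k).

(* A positive linear functional on the bounded nets indexed by the finite
   subsets of Delta (directed by inclusion) that extends the limit. The empty
   subset is harmless: it is not cofinal and has no steps. *)
Definition banach_limit (LIM : ({fset Delta} -> R) -> R) :=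
  [/\ (forall (a : R) (f g : {fset Delta} -> R), bounded_fun f -> bounded_fun g ->
         LIM (fun d => a * f d + g d) = a * LIM f + LIM g),
      (forall f : {fset Delta} -> R, bounded_fun f -> (forall d, 0 <= f d) -> 0 <= LIM f) &
      (forall (f : {fset Delta} -> R) (l : R), bounded_fun f ->
         f d @[d --> summability.totally] --> l -> LIM f = l)].

(* x in Mloc and x(f) = - LIM_d P int P^d(f) dX for f bounded measurable. *)
Definition corresponds (LIM : ({fset Delta} -> R) -> R)
    (X : Delta -> T -> R) (x : set (T * Delta) -> R) :=
  Mloc x /\
  forall f : T * Delta -> R, measurable_wrt Fbar f -> bounded_fun f ->
    is_ba_integral x f
      (- LIM (fun d => elementary_integral d (predictable_proj d f) X)).

End associated_measure.

(* Main.v *)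
From HB Require Import structures.
Require Import Defs.
From mathcomp Require Import all_boot all_order all_algebra finmap.
From mathcomp Require Import all_classical all_reals all_analysis.
From mathcomp Require Import measurable_realfun ring lra.

(** Write E_s for the conditional expectation given F_s, and call the L1 norm
    of X_s - E_s X_t the drop of X from s to t.

    Existence. The norm of a quasi-martingale X is the supremum, over finite
    chains, of the total drop along the chain. When this is finite, a nearly
    optimal chain leaves almost no drop beyond its last point: drops are
    uniformly small far out in Delta ([expected_drop_cauchy]). As
    conditional expectation is an L1 contraction, E_s X_a and E_s X_b differ
    in L1 by at most the drop of X from a to b, so the E_s X_v form a Cauchy
    net as v grows, uniformly in s. Their limit M_s exists by
    completeness of L1 ([limit_of_condexps_exists]); it is a martingale by the
    tower property, and X - M tends to 0 because s is arbitrary in the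
    uniform estimate. X may fail to be integrable; every distance is the L1
    norm of a difference.

    Uniqueness. If X = M + B is any decomposition, M_s - E_s X_v is the
    conditional expectation of -B_v, hence it is at most the L1 norm of B_v:
    M is forced to be the limit of the E_s X_v ([riesz_limit_of_condexps]).

    Order. Subtracting a martingale does not change X_s - E_s X_t
    ([expected_drop_riesz]). So X and B have the same norm, and
    one is a supermartingale if and only if the other is. A
    supermartingale B that vanishes at infinity is nonnegative since
    B_s >= E_s B_v, and M is nonnegative when X is, as the limit of E_s X_v.

    Uniform integrability. A family is uniformly integrable exactly when its
    members can be approximated in L1, to any given precision, by functions
    with a common bound ([uniformly_integrableP]). This property passes from
    a cofinal sequence of M to all of M, because every M_s is a conditional
    expectation of a term of the sequence, and between M and X along the
    sequence, because B tends to 0 in L1 there.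

    Generalized conditional expectations reduce to the integrable case by
    localization: Y has one given G exactly when the space is a countable
    union of sets of G over which Y is integrable ([has_condexpP]). On each of
    these sets the usual defining property holds, and almost sure
    statements are glued over the union ([ae_cover]). *)

Set Implicit Arguments.
Unset Strict Implicit.
Unset Printing Implicit Defensive.

Import Order.TTheory GRing.Theory Num.Theory.
Import numFieldNormedType.Exports.

Local Open Scope classical_set_scope.
Local Open Scope ring_scope.

(** * Sub-sigma-algebras *)

Section sub_sigma_algebra.
Context {R : realType} {dT : measure_display} {T : measurableType dT}.

Definition sub_sigma (G : set_system T) :=
  sigma_algebra setT G /\ G `<=` measurable.

Variable G : set_system T.
Hypothesis hG : sub_sigma G.

Let TG := g_sigma_algebraType G.

(** Measurability with respect to G is treated on the measurable space
    generated by G, whose measurable sets are exactly those of G. *)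
Lemma sub_sigma_measurableE : (measurable : set_system TG) = G.
Proof. by apply: sigma_algebra_id; case: hG. Qed.

Lemma sub_sigma_measurable A : G A -> measurable A.
Proof. by case: hG => _; apply. Qed.

Lemma measurable_wrtP (f : T -> R) :
  measurable_wrt G f <-> measurable_fun [set: TG] (f : TG -> R).
Proof.
split=> [h _ B mB|h A [B mB <-]].
  by rewrite sub_sigma_measurableE; apply: h; exists B.
by rewrite -sub_sigma_measurableE; exact: h.
Qed.

Lemma measurable_wrt_fun (f : T -> R) :
  measurable_wrt G f -> measurable_fun setT f.
Proof.
by move=> h _ B mB; apply: sub_sigma_measurable; apply: h; exists B.
Qed.

Lemma measurable_wrt_le (f g : T -> R) : measurable_wrt G f ->
  measurable_wrt G g -> G [set w | f w <= g w].
Proof.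
move=> /measurable_wrtP mf /measurable_wrtP mg.
rewrite -sub_sigma_measurableE -[X in measurable X]setTI.
exact: measurable_fun_le.
Qed.

Lemma measurable_wrt_cst (c : R) : measurable_wrt G (cst c).
Proof. by apply/measurable_wrtP; exact: measurable_cst. Qed.

Lemma sub_sigmaT : G setT.
Proof. by rewrite -sub_sigma_measurableE; exact: measurableT. Qed.

Lemma sub_sigma0 : G set0.
Proof. by rewrite -sub_sigma_measurableE; exact: measurable0. Qed.

Lemma sub_sigmaI A B : G A -> G B -> G (A `&` B).
Proof. by rewrite -sub_sigma_measurableE; exact: measurableI. Qed.

Lemma sub_sigmaD A B : G A -> G B -> G (A `\` B).
Proof. by rewrite -sub_sigma_measurableE; exact: measurableD. Qed.

Lemma measurable_idG : measurable_fun [set: T] (idfun : T -> TG).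
Proof.
move=> _ B mB; rewrite setTI; apply: sub_sigma_measurable.
by rewrite -sub_sigma_measurableE.
Qed.

End sub_sigma_algebra.

(** * Existence of conditional expectations *)

Section condexp_integrable.
Context {R : realType} {dT : measure_display} {T : measurableType dT}.
Variables (P : probability T R) (G : set_system T).
Hypothesis hG : sub_sigma G.
Variable Y : T -> R.
Hypothesis mY : measurable_fun setT Y.
Hypothesis Y0 : forall w, 0 <= Y w.
Hypothesis intY : (\int[P]_w (Y w)%:E < +oo)%E.

Let TG := g_sigma_algebraType G.
Let idG : T -> TG := idfun.
HB.instance Definition _ :=
  isMeasurableFun.Build _ _ _ _ idG (measurable_idG hG).

Let nu (A : set TG) : \bar R := \int[P]_(w in A) (Y w)%:E.

Let mYE : measurable_fun setT (EFin \o Y).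
Proof. exact/measurable_EFinP. Qed.

Let nu0 : nu set0 = 0%E.
Proof. by rewrite /nu integral_set0. Qed.

Let nu_ge0 A : (0 <= nu A)%E.
Proof. by apply: integral_ge0 => w _; rewrite lee_fin. Qed.

Let nu_sigma_additive : semi_sigma_additive nu.
Proof.
move=> A mA tA _; have mA' k : (measurable : set_system T) (A k).
  by apply: (sub_sigma_measurable hG); rewrite -(sub_sigma_measurableE hG).
rewrite /nu ge0_integral_bigcup//.
- by apply: is_cvg_ereal_nneg_natsum => k _; exact: nu_ge0.
- exact: measurable_funTS.
- by move=> w _; rewrite lee_fin.
Qed.

HB.instance Definition _ := isMeasure.Build _ TG R nu
  nu0 nu_ge0 nu_sigma_additive.

Let nu_fin : fin_num_fun nu.
Proof.
move=> A mA; rewrite ge0_fin_numE// (le_lt_trans _ intY)//.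
apply: ge0_subset_integral => //.
  by apply: (sub_sigma_measurable hG); rewrite -(sub_sigma_measurableE hG).
by move=> w _; rewrite lee_fin.
Qed.

HB.instance Definition _ := Measure_isFinite.Build _ TG R nu nu_fin.

Let nu_dominated : nu `<< distribution P idG.
Proof.
apply/null_content_dominatesP => A mA PA0.
have mA' : (measurable : set_system T) A.
  by apply: (sub_sigma_measurable hG); rewrite -(sub_sigma_measurableE hG).
apply: null_set_integral => //; exact: measurable_funTS.
Qed.

(** The Radon-Nikodym derivative of A |-> \int_A Y with respect to P, both
    restricted to G; the restriction of P is the law under P of the identity map
    from T to T equipped with G. *)
Lemma condexp_nneg_integrable : exists Z, is_condexp_nneg P G Y Z.
Proof.
have [f [f0 ffin /measurable_int mf fE]] :=
  radon_nikodym_sigma_finite nu_dominated.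
have mG A : G A -> (measurable : set_system TG) A.
  by rewrite (sub_sigma_measurableE hG).
exists (fine \o f); split.
- apply/(measurable_wrtP hG); exact: measurableT_comp.
- by move=> w; apply: fine_ge0.
- move=> A /mG mA; transitivity (nu A) => //; rewrite [RHS]fE//.
  rewrite ge0_integral_pushforward//.
  - by apply: eq_integral => w _; rewrite /= fineK.
  - exact: measurable_funTS.
Qed.

End condexp_integrable.

Section condexp_existence.
Context {R : realType} {dT : measure_display} {T : measurableType dT}.
Variables (P : probability T R) (G : set_system T).
Hypothesis hG : sub_sigma G.

Definition absint (A : set T) (f : T -> R) : \bar R :=
  \int[P]_(w in A) `|f w|%:E.

(** sigma-finiteness on G of the measure A |-> \int_A |f|. *)
Definition sigma_integrable (f : T -> R) := exists A : nat -> set T,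
  [/\ forall n, G (A n), \bigcup_n A n = setT &
      forall n, (absint (A n) f < +oo)%E].

Lemma absint_ge0 A f : (0 <= absint A f)%E.
Proof. by apply: integral_ge0 => w _; rewrite lee_fin. Qed.

Lemma measurable_EFin_norm (A : set T) (f : T -> R) :
  measurable_fun setT f -> measurable_fun A (fun w => `|f w|%:E).
Proof.
move=> mf; apply: (measurable_funS measurableT) => //.
by apply/measurable_EFinP; exact: measurableT_comp.
Qed.

Lemma le_absint A (f g : T -> R) : measurable A ->
  measurable_fun setT f -> measurable_fun setT g ->
  (forall w, A w -> `|f w| <= `|g w|) -> (absint A f <= absint A g)%E.
Proof.
move=> mA mf mg fg.
by apply: ge0_le_integral => //; exact: measurable_EFin_norm.
Qed.

Lemma absint_subset A B f : measurable A -> measurable B ->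
  measurable_fun setT f -> A `<=` B -> (absint A f <= absint B f)%E.
Proof.
move=> mA mB mf AB; apply: ge0_subset_integral => //.
exact: measurable_EFin_norm.
Qed.

Lemma absint_integrable A f : measurable A -> measurable_fun setT f ->
  (absint A f < +oo)%E -> P.-integrable A (EFin \o f).
Proof.
move=> mA mf Af; apply/integrableP; split => //.
by apply/measurable_EFinP; exact: measurable_funTS.
Qed.

(** The covering sets are made disjoint, the integrable case is applied to Y
    restricted to each piece, and the results are pasted together; countable
    additivity of the integrals gives the defining identity for the whole. *)
Lemma condexp_nneg_exists (Y : T -> R) :
  measurable_fun setT Y -> (forall w, 0 <= Y w) ->
  sigma_integrable Y -> exists Z, is_condexp_nneg P G Y Z.
Proof.
move=> mY Y0 [A [GA AT Aoo]].
pose D := seqDU A.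
have GD n : G (D n).
  have := GA; rewrite -(sub_sigma_measurableE hG) => mA.
  by apply: measurableD => //; apply: bigsetU_measurable.
have mD n : measurable (D n) by exact: sub_sigma_measurable (GD n).
have DT : \bigcup_n D n = setT by rewrite -seqDU_bigcup_eq.
have tD : trivIset setT D by exact: trivIset_seqDU.
have mYE B : measurable_fun B (EFin \o Y).
  by apply/measurable_EFinP; exact: measurable_funTS.
have /choice[Z_ Z_E] n : exists Z, is_condexp_nneg P G (Y \_ (D n)) Z.
  apply: condexp_nneg_integrable => //.
  - by apply/measurable_restrict => //; exact: measurable_funTS.
  - by move=> w; rewrite patchE; case: ifPn.
  - rewrite (_ : (fun w => _) = (EFin \o Y) \_ (D n)); last first.
      by apply/funext => w; rewrite /= !patchE; case: ifPn.
    rewrite -integral_mkcond; apply: le_lt_trans (Aoo n).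
    rewrite (_ : absint _ _ = (\int[P]_(w in A n) (Y w)%:E)%E); last first.
      by apply: eq_integral => w _; rewrite ger0_norm.
    apply: ge0_subset_integral => //.
    + exact: sub_sigma_measurable (GA n).
    + by move=> w _; rewrite lee_fin.
    + exact: subDsetl.
have /choice[r rE] w : exists n, D n w.
  by have : setT w by []; rewrite -DT => -[n _ ?]; exists n.
have rD n w : D n w -> r w = n.
  move=> Dw; apply: contrapT => /eqP ne.
  move/trivIsetP : tD => /(_ (r w) n I I ne)/eqP; apply/negP/eqP => D0.
  by have : set0 w by rewrite -D0; split => //; exact: rE.
pose Z w := Z_ (r w) w.
have mZ : measurable_wrt G Z.
  apply/(measurable_wrtP hG); rewrite -DT.
  apply/measurable_fun_bigcup => [n|n].
    by rewrite (sub_sigma_measurableE hG).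
  apply: (@eq_measurable_fun _ _ (g_sigma_algebraType G) _ (D n) (Z_ n)).
    by move=> w /set_mem/rD; rewrite /Z => ->.
  by apply: measurable_funTS; apply/(measurable_wrtP hG); case: (Z_E n).
have Z0 w : 0 <= Z w by case: (Z_E (r w)) => _ + _; apply.
exists Z; split => // B GB.
have mB := sub_sigma_measurable hG GB.
have BE : B = \bigcup_n (B `&` D n) by rewrite -setI_bigcupr DT setIT.
have mBD n : measurable (B `&` D n) by exact: measurableI.
have tBD : trivIset setT (fun n => B `&` D n) by exact: trivIset_setIl.
have mZE C : measurable_fun C (EFin \o Z).
  by apply/measurable_EFinP/measurable_funTS; exact: measurable_wrt_fun mZ.
rewrite BE ge0_integral_bigcup//; last by move=> w _; rewrite lee_fin.
rewrite ge0_integral_bigcup//; last by move=> w _; rewrite lee_fin.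
apply: eq_eseriesr => n _.
have [_ _ ZnE] := Z_E n.
transitivity (\int[P]_(w in B `&` D n) (Z_ n w)%:E)%E.
  by apply: eq_integral => w /set_mem[_ /rD]; rewrite /Z => ->.
rewrite ZnE; last exact: sub_sigmaI.
by apply: eq_integral => w /set_mem[_ Dw]; rewrite patchE mem_set.
Qed.

Lemma absint_funrpos A (Y : T -> R) : measurable A -> measurable_fun setT Y ->
  absint A Y = (\int[P]_(w in A) (Y^\+ w)%:E + \int[P]_(w in A) (Y^\- w)%:E)%E.
Proof.
move=> mA mY; rewrite -ge0_integralD//.
- apply: eq_integral => w _.
  by rewrite -EFinD -[ `|Y w| ]/((Num.norm \o Y) w) -funrposDneg.
- by move=> w _; rewrite lee_fin.
- by apply/measurable_EFinP/measurable_funTS; exact: measurable_funrpos.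
- by move=> w _; rewrite lee_fin.
- by apply/measurable_EFinP/measurable_funTS; exact: measurable_funrneg.
Qed.

(** If Y^+ and Y^- have conditional expectations Zp and Zm, Y is integrable over
    the sets {Zp <= n, Zm <= n}, which cover the space because Zp and Zm are
    finite. Conversely, Y^+ and Y^- are dominated by |Y|. *)
Lemma has_condexpP (Y : T -> R) : measurable_fun setT Y ->
  has_condexp P G Y <-> sigma_integrable Y.
Proof.
move=> mY; split=> [[Z [Zp [Zm [[mZp Zp0 ZpE] [mZm Zm0 ZmE] ZE]]]]|].
  pose A n := [set w | Zp w <= n%:R] `&` [set w | Zm w <= n%:R].
  have GA n : G (A n).
    by apply: sub_sigmaI => //; apply: measurable_wrt_le => //;
      exact: measurable_wrt_cst.
  exists A; split => //.
    apply/seteqP; split => // w _.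
    exists (Num.truncn (Num.max (Zp w) (Zm w))).+1 => //.
    suff : Num.max (Zp w) (Zm w) <= (Num.truncn (Num.max (Zp w) (Zm w))).+1%:R.
      by rewrite ge_max => /andP[].
    exact/ltW/truncnS_gt.
  have cstA n Z' : measurable_wrt G Z' -> (forall w, A n w -> Z' w <= n%:R) ->
      (forall w, 0 <= Z' w) -> (\int[P]_(w in A n) (Z' w)%:E < +oo)%E.
    move=> mZ' Z'n Z'0.
    have mA := sub_sigma_measurable hG (GA n).
    apply: (@le_lt_trans _ _ (\int[P]_(w in A n) (n%:R)%:E)%E).
      apply: ge0_le_integral => //.
      - by move=> w _; rewrite lee_fin.
      - apply/measurable_EFinP/measurable_funTS.
        exact: measurable_wrt_fun mZ'.
    rewrite integral_cst// -ge0_fin_numE ?mule_ge0 ?lee_fin//.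
    by rewrite fin_numM ?fin_num_measure.
  move=> n; rewrite absint_funrpos//; last exact: sub_sigma_measurable (GA n).
  rewrite -ZpE// -ZmE//; apply: lte_add_pinfty.
    by apply: cstA => // w [].
  by apply: cstA => // w [].
move=> [A [GA AT Aoo]].
have h (Y' : T -> R) : measurable_fun setT Y' -> (forall w, 0 <= Y' w) ->
    (forall w, Y' w <= `|Y w|) -> exists Z, is_condexp_nneg P G Y' Z.
  move=> mY' Y'0 Y'Y; apply: condexp_nneg_exists => //.
  exists A; split => // n; apply: le_lt_trans (Aoo n).
  apply: le_absint => //; first exact: sub_sigma_measurable (GA n).
  by move=> w _; rewrite ger0_norm.
have [|//||Zp ZpE] := h Y^\+; first exact: measurable_funrpos.
  by move=> w; rewrite -[leRHS]/((Num.norm \o Y) w) -funrposDneg/= lerDl.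
have [|//||Zm ZmE] := h Y^\-; first exact: measurable_funrneg.
  by move=> w; rewrite -[leRHS]/((Num.norm \o Y) w) -funrposDneg/= lerDr.
by exists (Zp \- Zm), Zp, Zm.
Qed.

End condexp_existence.

(** * Calculus of generalized conditional expectations *)

Section condexp_calculus.
Context {R : realType} {dT : measure_display} {T : measurableType dT}.
Variable P : probability T R.
Implicit Types (f g Y Z : T -> R) (G H : set_system T).

Lemma absint_ae A f g : measurable A -> measurable_fun setT f ->
  measurable_fun setT g -> {ae P, forall w, f w = g w} ->
  absint P A f = absint P A g.
Proof.
move=> mA mf mg fg; apply: ge0_ae_eq_integral => //.
- exact: measurable_EFin_norm.
- exact: measurable_EFin_norm.
- by apply: filterS fg => w ->.
Qed.

Lemma absintD A f g : measurable A -> measurable_fun setT f ->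
  measurable_fun setT g ->
  (absint P A (fun w => f w + g w)%R <= absint P A f + absint P A g)%E.
Proof.
move=> mA mf mg; rewrite /absint -ge0_integralD//; first last.
- exact: measurable_EFin_norm.
- exact: measurable_EFin_norm.
apply: ge0_le_integral => //.
- by apply: measurable_EFin_norm; exact: measurable_funD.
- by apply: emeasurable_funD; exact: measurable_EFin_norm.
- by move=> w _; rewrite -EFinD lee_fin ler_normD.
Qed.

Lemma absintN A f : absint P A (fun w => - f w) = absint P A f.
Proof. by apply: eq_integral => w _; rewrite normrN. Qed.

Lemma absintB A f g : measurable A -> measurable_fun setT f ->
  measurable_fun setT g ->
  (absint P A (fun w => f w - g w)%R <= absint P A f + absint P A g)%E.
Proof.
move=> mA mf mg; rewrite -(absintN A g); apply: absintD => //.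
exact: measurableT_comp.
Qed.

Lemma absint0_ae f : measurable_fun setT f -> absint P setT f = 0%E ->
  {ae P, forall w, f w = 0}.
Proof.
move=> mf f0.
have mfE : measurable_fun setT (EFin \o f) by exact/measurable_EFinP.
have [N [mN N0 NB]] := (ae_eq_integral_abs P measurableT mfE).1 f0.
by exists N; split => // w /= nf; apply: NB => /= /(_ I)[].
Qed.

Lemma absint_triangle (f g h : T -> R) : measurable_fun setT f ->
  measurable_fun setT g -> measurable_fun setT h ->
  (absint P setT (fun w => f w - h w)%R <=
   absint P setT (fun w => f w - g w)%R +
   absint P setT (fun w => g w - h w)%R)%E.
Proof.
move=> mf mg mh; rewrite (_ : (fun w => f w - h w) =
    fun w => (f w - g w) + (g w - h w)); last first.
  by apply/funext => w; rewrite addrA subrK.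
by apply: absintD => //; exact: measurable_funB.
Qed.

Lemma absint_sym (f g : T -> R) :
  absint P setT (fun w => f w - g w)%R = absint P setT (fun w => g w - f w)%R.
Proof. by apply: eq_integral => w _; rewrite distrC. Qed.

Lemma absint_small_ae (f : T -> R) : measurable_fun setT f ->
  (forall e : R, 0 < e -> (absint P setT f <= e%:E)%E) ->
  {ae P, forall w, f w = 0}.
Proof.
move=> mf h; apply: absint0_ae => //; apply/eqP.
rewrite eq_le absint_ge0 andbT; apply/lee_addgt0Pr => e e0.
by rewrite add0e h.
Qed.

(** The negative part of f is at most |f - Z| wherever Z >= 0. *)
Lemma ae_ge0_of_approx (f : T -> R) : measurable_fun setT f ->
  (forall e : R, 0 < e -> exists Z : T -> R, [/\ measurable_fun setT Z,
     {ae P, forall w, 0 <= Z w} &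
     (absint P setT (fun w => f w - Z w)%R <= e%:E)%E]) ->
  {ae P, forall w, 0 <= f w}.
Proof.
move=> mf h.
suff : {ae P, forall w, f^\- w = 0}.
  by apply: filterS => w; rewrite /funrneg => /max_idPr; rewrite oppr_le0.
apply: absint_small_ae; first exact: measurable_funrneg.
move=> e /h[Z [mZ Z0 fZ]]; apply: le_trans fZ.
apply: ae_ge0_le_integral => //.
- by apply: measurable_EFin_norm; exact: measurable_funrneg.
- by apply: measurable_EFin_norm; exact: measurable_funB.
apply: filterS Z0 => w Z0 _; rewrite lee_fin ger0_norm// /funrneg.
rewrite ge_max normr_ge0 andbT -normrN opprB.
by apply: le_trans (ler_norm _); rewrite lerDr.
Qed.

(** Gluing principle for the localization to sets of integrability. *)
Lemma ae_cover (A : nat -> set T) (Q : T -> Prop) : \bigcup_n A n = setT ->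
  (forall n, {ae P, forall w, A n w -> Q w}) -> {ae P, forall w, Q w}.
Proof.
move=> AT /ae_foralln; apply: filterS => w h.
by have : setT w by []; rewrite -AT => -[n _]; exact: h.
Qed.

(** The common cover consists of the pairwise intersections, enumerated by a
    coding of pairs of integers. *)
Lemma sigma_integrable2 G f g : sub_sigma G -> measurable_fun setT f ->
  measurable_fun setT g -> sigma_integrable P G f -> sigma_integrable P G g ->
  exists A : nat -> set T, [/\ forall n, G (A n), \bigcup_n A n = setT,
    forall n, (absint P (A n) f < +oo)%E &
    forall n, (absint P (A n) g < +oo)%E].
Proof.
move=> hG mf mg [A [GA AT Af]] [B [GB BT Bg]].
pose C k := if @choice.unpickle (nat * nat)%type k is Some nm
  then A nm.1 `&` B nm.2 else set0.
have CE n m : C (choice.pickle (n, m)) = A n `&` B m.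
  by rewrite /C choice.pickleK.
have h k (Q : set T -> Prop) :
    Q set0 -> (forall n m, Q (A n `&` B m)) -> Q (C k).
  by move=> Q0 QAB; rewrite /C; case: choice.unpickle => // -[].
exists C; split.
- by move=> k; apply: h => [|n m]; [exact: sub_sigma0|exact: sub_sigmaI].
- apply/seteqP; split => // w _.
  have : (\bigcup_n A n) w by rewrite AT.
  have : (\bigcup_n B n) w by rewrite BT.
  by move=> [m _ Bm] [n _ An]; exists (choice.pickle (n, m)) => //; rewrite CE.
- move=> k; apply: (h k (fun S => absint P S f < +oo)%E) => [|n m].
    by rewrite /absint integral_set0.
  apply: le_lt_trans (Af n); apply: absint_subset => //.
  + by apply: (sub_sigma_measurable hG); exact: sub_sigmaI.
  + exact: sub_sigma_measurable (GA n).
- move=> k; apply: (h k (fun S => absint P S g < +oo)%E) => [|n m].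
    by rewrite /absint integral_set0.
  apply: le_lt_trans (Bg m); apply: absint_subset => //.
  + by apply: (sub_sigma_measurable hG); exact: sub_sigmaI.
  + exact: sub_sigma_measurable (GB m).
Qed.

Lemma sigma_integrableB G f g : sub_sigma G -> measurable_fun setT f ->
  measurable_fun setT g -> sigma_integrable P G f -> sigma_integrable P G g ->
  sigma_integrable P G (fun w => f w - g w).
Proof.
move=> hG mf mg sf sg.
have [A [GA AT Af Ag]] := sigma_integrable2 hG mf mg sf sg.
exists A; split => // n; apply: (le_lt_trans (absintB _ mf mg)).
  exact: sub_sigma_measurable (GA n).
exact: lte_add_pinfty.
Qed.

Lemma sigma_integrableD G f g : sub_sigma G -> measurable_fun setT f ->
  measurable_fun setT g -> sigma_integrable P G f -> sigma_integrable P G g ->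
  sigma_integrable P G (fun w => f w + g w).
Proof.
move=> hG mf mg sf sg.
have [A [GA AT Af Ag]] := sigma_integrable2 hG mf mg sf sg.
exists A; split => // n; apply: (le_lt_trans (absintD _ mf mg)).
  exact: sub_sigma_measurable (GA n).
exact: lte_add_pinfty.
Qed.

Lemma sigma_integrable_ae G f g : sub_sigma G -> measurable_fun setT f ->
  measurable_fun setT g -> {ae P, forall w, f w = g w} ->
  sigma_integrable P G f -> sigma_integrable P G g.
Proof.
move=> hG mf mg fg [A [GA AT Af]]; exists A; split => // n.
by rewrite -(absint_ae _ mf mg fg)//; exact: sub_sigma_measurable (GA n).
Qed.

Lemma integrable_sigma_integrable G f : sub_sigma G ->
  (absint P setT f < +oo)%E -> sigma_integrable P G f.
Proof.
move=> hG foo; exists (fun=> setT); split => //.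
  by move=> _; exact: sub_sigmaT.
by apply/seteqP; split => // w _; exists 0%N.
Qed.

Lemma sigma_integrable_sub G H f : G `<=` H -> sigma_integrable P G f ->
  sigma_integrable P H f.
Proof. by move=> GH [A [GA AT Af]]; exists A; split => // n; exact: GH. Qed.

Section fixed_sigma_algebra.
Variable G : set_system T.
Hypothesis hG : sub_sigma G.

Lemma condexpP Y : measurable_fun setT Y -> sigma_integrable P G Y ->
  is_condexp P G Y (condexp P G Y).
Proof. by move=> mY /(has_condexpP P hG mY) h; exact: xgetPex. Qed.

Lemma condexp_wrt Y : measurable_wrt G (condexp P G Y).
Proof.
have [[Z h]|h] := pselect (has_condexp P G Y).
  have [Zp [Zm [[mp _ _] [mm _ _] ->]]] : is_condexp P G Y (condexp P G Y).
    by apply: xgetPex; exists Z.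
  apply/(measurable_wrtP hG).
  by apply: measurable_funB; exact/(measurable_wrtP hG).
rewrite /condexp xgetPN; first exact: measurable_wrt_cst.
by move=> Z hZ; apply: h; exists Z.
Qed.

Lemma measurable_condexp Y : measurable_fun setT (condexp P G Y).
Proof. exact (measurable_wrt_fun hG (@condexp_wrt Y)). Qed.

(** |Z| <= Zp + Zm, and the integral of Zp + Zm over A is that of |Y|. *)
Lemma absint_condexp A Y : measurable_fun setT Y -> sigma_integrable P G Y ->
  G A -> (absint P A (condexp P G Y) <= absint P A Y)%E.
Proof.
move=> mY sY GA; have mA := sub_sigma_measurable hG GA.
have [Zp [Zm [[mp p0 pE] [mm m0 mE] ->]]] := condexpP mY sY.
have {}mp := measurable_wrt_fun hG mp; have {}mm := measurable_wrt_fun hG mm.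
rewrite [leRHS]absint_funrpos// -pE// -mE//.
apply: le_trans (absintB mA mp mm) _.
by rewrite /absint; apply: leeD; apply: ge0_le_integral => //;
  by [exact: measurable_EFin_norm|apply/measurable_EFinP/measurable_funTS|
      move=> w _; rewrite ?lee_fin ?ger0_norm].
Qed.

Lemma integral_condexp A Y : measurable_fun setT Y -> sigma_integrable P G Y ->
  G A -> (absint P A Y < +oo)%E ->
  (\int[P]_(w in A) (condexp P G Y w)%:E = \int[P]_(w in A) (Y w)%:E)%E.
Proof.
move=> mY sY GA Yoo; have mA := sub_sigma_measurable hG GA.
have [Zp [Zm [[mp p0 pE] [mm m0 mE] ->]]] := condexpP mY sY.
have {}mp := measurable_wrt_fun hG mp; have {}mm := measurable_wrt_fun hG mm.
rewrite [RHS]integralE funerpos funerneg -pE// -mE//.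
rewrite -integralB_EFin//; apply: absint_integrable => //.
- rewrite (_ : absint _ _ _ = \int[P]_(w in A) (Zp w)%:E)%E; last first.
    by apply: eq_integral => w _; rewrite ger0_norm.
  rewrite pE//; apply: le_lt_trans Yoo; rewrite absint_funrpos//.
  by rewrite leeDl// integral_ge0// => w _; rewrite lee_fin.
- rewrite (_ : absint _ _ _ = \int[P]_(w in A) (Zm w)%:E)%E; last first.
    by apply: eq_integral => w _; rewrite ger0_norm.
  rewrite mE//; apply: le_lt_trans Yoo; rewrite absint_funrpos//.
  by rewrite leeDr// integral_ge0// => w _; rewrite lee_fin.
Qed.

(** Over B = A \ {Z <= Z'} the integral of |Z - Z'| is the difference of the
    integrals of Z and Z', hence not positive; so Z = Z' almost everywhere on B,
    which means that B is negligible. *)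
Lemma ae_le_local A Z Z' : G A -> measurable_wrt G Z -> measurable_wrt G Z' ->
  (absint P A Z < +oo)%E -> (absint P A Z' < +oo)%E ->
  (forall B, G B -> B `<=` A ->
    \int[P]_(w in B) (Z w)%:E <= \int[P]_(w in B) (Z' w)%:E)%E ->
  {ae P, forall w, A w -> Z w <= Z' w}.
Proof.
move=> GA wZ wZ' Zoo Z'oo h.
have mZ := measurable_wrt_fun hG wZ; have mZ' := measurable_wrt_fun hG wZ'.
pose B := A `\` [set w | Z w <= Z' w].
have GB : G B by apply: sub_sigmaD => //; exact: measurable_wrt_le.
have BA : B `<=` A by exact: subDsetl.
have mA := sub_sigma_measurable hG GA.
have mB := sub_sigma_measurable hG GB.
have intB f : measurable_fun setT f -> (absint P A f < +oo)%E ->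
    P.-integrable B (EFin \o f).
  move=> mf foo; apply: absint_integrable => //.
  by apply: le_lt_trans foo; exact: absint_subset.
have BE w : B w -> `|Z w - Z' w| = Z w - Z' w.
  by move=> [_ /negP]; rewrite -ltNge => /ltW ?; rewrite ger0_norm// subr_ge0.
have B0 : (\int[P]_(w in B) `|(Z w - Z' w)%:E| = 0)%E.
  apply/eqP; rewrite eq_le integral_ge0// andbT.
  rewrite (eq_integral (fun w => (Z w)%:E - (Z' w)%:E)%E); last first.
    by move=> w /set_mem Bw; rewrite /= BE.
  rewrite integralB_EFin//; [|exact: intB|exact: intB].
  rewrite leeBlDr ?add0e ?h//.
  by apply: integrable_fin_num => //; exact: intB.
have mE : measurable_fun B (EFin \o (fun w => Z w - Z' w)).
  by apply/measurable_EFinP/measurable_funTS; exact: measurable_funB.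
have [N [mN N0 NB]] := (ae_eq_integral_abs P mB mE).1 B0.
exists N; split => // w /= /not_implyP[Aw ZZ'].
apply: NB => /= /(_ (conj Aw ZZ'))[/eqP]; rewrite subr_eq0 => /eqP e.
by apply: ZZ'; rewrite e.
Qed.

Lemma ae_eq_local A Z Z' : G A -> measurable_wrt G Z -> measurable_wrt G Z' ->
  (absint P A Z < +oo)%E -> (absint P A Z' < +oo)%E ->
  (forall B, G B -> B `<=` A ->
    \int[P]_(w in B) (Z w)%:E = \int[P]_(w in B) (Z' w)%:E)%E ->
  {ae P, forall w, A w -> Z w = Z' w}.
Proof.
move=> GA wZ wZ' Zoo Z'oo h.
have h1 : {ae P, forall w, A w -> Z w <= Z' w}.
  by apply: ae_le_local => // B GB BA; rewrite h.
have h2 : {ae P, forall w, A w -> Z' w <= Z w}.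
  by apply: ae_le_local => // B GB BA; rewrite h.
by apply: filterS2 h1 h2 => w l1 l2 Aw; apply/eqP; rewrite eq_le l1 ?l2.
Qed.

(** Y is first replaced by min(Y, Y'), which is almost everywhere the same
    function and lies below Y' at every point. *)
Lemma le_condexp Y Y' : measurable_fun setT Y -> measurable_fun setT Y' ->
  sigma_integrable P G Y -> sigma_integrable P G Y' ->
  {ae P, forall w, Y w <= Y' w} ->
  {ae P, forall w, condexp P G Y w <= condexp P G Y' w}.
Proof.
move=> mY mY' sY sY' YY'.
have [A [GA AT AY AY']] := sigma_integrable2 hG mY mY' sY sY'.
apply: (ae_cover AT) => n.
apply: (ae_le_local (GA n) (@condexp_wrt Y) (@condexp_wrt Y')).
- by apply: le_lt_trans (AY n); exact: absint_condexp.
- by apply: le_lt_trans (AY' n); exact: absint_condexp.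
move=> B GB BA; have mB := sub_sigma_measurable hG GB.
have mA := sub_sigma_measurable hG (GA n).
have BY : (absint P B Y < +oo)%E.
  by apply: le_lt_trans (AY n); exact: absint_subset.
have BY' : (absint P B Y' < +oo)%E.
  by apply: le_lt_trans (AY' n); exact: absint_subset.
rewrite !integral_condexp//.
pose Ym w := Num.min (Y w) (Y' w).
have mYm : measurable_fun setT Ym by exact: measurable_minr.
have YE : {ae P, forall w, Y w = Ym w}.
  by apply: filterS YY' => w; rewrite /Ym => /min_idPl ->.
rewrite (ae_eq_integral (EFin \o Ym))//.
- apply: le_integral => //; try exact: absint_integrable.
  + by apply: absint_integrable => //; rewrite -(absint_ae mB mY mYm YE).
  + by move=> w _; rewrite lee_fin ge_min lexx orbT.
- by apply/measurable_EFinP/measurable_funTS.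
- by apply/measurable_EFinP/measurable_funTS.
- by apply: filterS YE => w /= ->.
Qed.

Lemma condexp_ae Y Y' : measurable_fun setT Y -> measurable_fun setT Y' ->
  sigma_integrable P G Y -> {ae P, forall w, Y w = Y' w} ->
  {ae P, forall w, condexp P G Y w = condexp P G Y' w}.
Proof.
move=> mY mY' sY YY'.
have sY' : sigma_integrable P G Y' by exact: sigma_integrable_ae YY' sY.
have h1 : {ae P, forall w, condexp P G Y w <= condexp P G Y' w}.
  by apply: le_condexp => //; apply: filterS YY' => w ->.
have h2 : {ae P, forall w, condexp P G Y' w <= condexp P G Y w}.
  by apply: le_condexp => //; apply: filterS YY' => w ->.
by apply: filterS2 h1 h2 => w l1 l2; apply/eqP; rewrite eq_le l1 ?l2.
Qed.

Lemma condexpB Y Y' : measurable_fun setT Y -> measurable_fun setT Y' ->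
  sigma_integrable P G Y -> sigma_integrable P G Y' ->
  {ae P, forall w, condexp P G (fun w => Y w - Y' w) w =
                   condexp P G Y w - condexp P G Y' w}.
Proof.
move=> mY mY' sY sY'.
have sYY' := sigma_integrableB hG mY mY' sY sY'.
have mYY' : measurable_fun setT (fun w => Y w - Y' w) by exact: measurable_funB.
have [A [GA AT AY AY']] := sigma_integrable2 hG mY mY' sY sY'.
apply: (ae_cover AT) => n.
have mA := sub_sigma_measurable hG (GA n).
have mc := measurable_condexp.
have cY : (absint P (A n) (condexp P G Y) < +oo)%E.
  by apply: le_lt_trans (AY n); exact: absint_condexp.
have cY' : (absint P (A n) (condexp P G Y') < +oo)%E.
  by apply: le_lt_trans (AY' n); exact: absint_condexp.
have AYY' : (absint P (A n) (fun w => Y w - Y' w)%R < +oo)%E.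
  by apply: le_lt_trans (absintB mA mY mY') _; exact: lte_add_pinfty.
have wB : measurable_wrt G (fun w => condexp P G Y w - condexp P G Y' w).
  apply/(measurable_wrtP hG); apply: measurable_funB.
    exact (iffLR (measurable_wrtP hG _) (@condexp_wrt Y)).
  exact (iffLR (measurable_wrtP hG _) (@condexp_wrt Y')).
apply: (ae_eq_local (GA n) (@condexp_wrt _) wB).
- by apply: le_lt_trans AYY'; exact: absint_condexp.
- exact (le_lt_trans (absintB mA (mc Y) (mc Y')) (lte_add_pinfty cY cY')).
move=> B GB BA; have mB := sub_sigma_measurable hG GB.
have BS f : measurable_fun setT f -> (absint P (A n) f < +oo)%E ->
    (absint P B f < +oo)%E.
  by move=> mf; apply: le_lt_trans; exact: absint_subset.
rewrite integral_condexp//; last exact: BS.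
under eq_integral do rewrite EFinB.
under [RHS]eq_integral do rewrite EFinB.
have iB f : measurable_fun setT f -> (absint P (A n) f < +oo)%E ->
    P.-integrable B (EFin \o f).
  by move=> mf foo; apply: absint_integrable => //; exact: BS.
rewrite (integralB_EFin mB (iB _ mY (AY n)) (iB _ mY' (AY' n))).
rewrite (integralB_EFin mB (iB _ (mc Y) cY) (iB _ (mc Y') cY')).
by rewrite !integral_condexp//; apply: BS.
Qed.

Lemma measurable_wrt_has_condexp Y : measurable_wrt G Y -> is_condexp P G Y Y.
Proof.
move=> wY; exists Y^\+, Y^\-; split.
- split => //.
  exact/(measurable_wrtP hG)/measurable_funrpos/(measurable_wrtP hG).
- split => //.
  exact/(measurable_wrtP hG)/measurable_funrneg/(measurable_wrtP hG).
- by rewrite -[LHS]funrposBneg.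
Qed.

Lemma measurable_wrt_sigma_integrable Y : measurable_wrt G Y ->
  sigma_integrable P G Y.
Proof.
move=> wY; apply/(has_condexpP P hG); first exact: (measurable_wrt_fun hG wY).
by exists Y; exact: measurable_wrt_has_condexp.
Qed.

Lemma condexp_id Y : measurable_wrt G Y ->
  {ae P, forall w, condexp P G Y w = Y w}.
Proof.
move=> wY; have mY := measurable_wrt_fun hG wY.
have sY := measurable_wrt_sigma_integrable wY.
have [A [GA AT AY]] := sY; apply: (ae_cover AT) => n.
apply: (ae_eq_local (GA n) (@condexp_wrt Y) wY) => //.
  by apply: le_lt_trans (AY n); exact: absint_condexp.
move=> B GB BA; rewrite integral_condexp//.
apply: le_lt_trans (AY n); apply: absint_subset => //.
  exact: sub_sigma_measurable GB.
exact: sub_sigma_measurable (GA n).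
Qed.

(** This makes sense for functions that are not integrable themselves, which is
    how the convergence of the E_s X_v is controlled. *)
Lemma condexp_contraction Y Y' :
  measurable_fun setT Y -> measurable_fun setT Y' ->
  sigma_integrable P G Y -> sigma_integrable P G Y' ->
  (absint P setT (fun w => condexp P G Y w - condexp P G Y' w)%R <=
   absint P setT (fun w => Y w - Y' w)%R)%E.
Proof.
move=> mY mY' sY sY'.
have mYY' : measurable_fun setT (fun w => Y w - Y' w) by exact: measurable_funB.
rewrite -(absint_ae _ _ _ (condexpB mY mY' sY sY'))//.
- apply: absint_condexp => //; first exact: sigma_integrableB.
  exact: sub_sigmaT.
- exact: measurable_condexp.
- by apply: measurable_funB; exact: measurable_condexp.
Qed.

End fixed_sigma_algebra.

(** The sets of G over which Y is integrable also belong to H, so E(Y|H) is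
    integrable over them and has the same integral as Y. *)
Lemma condexp_tower G H Y : sub_sigma G -> sub_sigma H -> G `<=` H ->
  measurable_fun setT Y -> sigma_integrable P G Y ->
  sigma_integrable P G (condexp P H Y) /\
  {ae P, forall w, condexp P G (condexp P H Y) w = condexp P G Y w}.
Proof.
move=> hG hH GH mY sY; have [A [GA AT AY]] := sY.
have sHY := sigma_integrable_sub GH sY.
have mHY := measurable_condexp hH Y.
have AHY n : (absint P (A n) (condexp P H Y) < +oo)%E.
  by apply: le_lt_trans (AY n); apply: absint_condexp => //; exact: GH.
have sGHY : sigma_integrable P G (condexp P H Y) by exists A.
split => //; apply: (ae_cover AT) => n.
have wG Z : measurable_wrt G (condexp P G Z) by move=> B; exact: condexp_wrt.
apply: (ae_eq_local hG (GA n) (wG (condexp P H Y)) (wG Y)).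
- by apply: le_lt_trans (AHY n); exact: absint_condexp.
- by apply: le_lt_trans (AY n); exact: absint_condexp.
move=> B GB BA; have mB := sub_sigma_measurable hG GB.
have mA := sub_sigma_measurable hG (GA n).
have BS f : measurable_fun setT f -> (absint P (A n) f < +oo)%E ->
    (absint P B f < +oo)%E.
  by move=> mf; apply: le_lt_trans; exact: absint_subset.
rewrite (integral_condexp hG)//; last exact: BS.
rewrite (integral_condexp hH)//; [|exact: GH|exact: BS].
by rewrite (integral_condexp hG)//; exact: BS.
Qed.

End condexp_calculus.

(** * Completeness of L1 over a sub-sigma-algebra *)

Section L1_completeness.
Context {R : realType} {dT : measure_display} {T : measurableType dT}.
Variable P : probability T R.
Implicit Types (f : nat -> T -> R) (g : T -> R) (G : set_system T).

(** 2 - 2 * 2^-n is the sum of the first n terms of the series of 2^-k. *)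
Lemma absint_telescope f (c : R) : (forall n, measurable_fun setT (f n)) ->
  (forall n,
    absint P setT (fun w => f n.+1 w - f n w)%R <= (c * 2 ^- n)%:E)%E ->
  forall n, (absint P setT (fun w => f n w - f 0%N w)%R
             <= (c * (2 - 2 * 2 ^- n))%:E)%E.
Proof.
move=> mf h; elim=> [|n IH].
  rewrite expr0 invr1 mulr1 subrr mulr0 (_ : absint _ _ _ = 0%E)//.
  by rewrite /absint integral0_eq// => w _; rewrite subrr normr0.
have -> : (fun w => f n.+1 w - f 0%N w) =
    (fun w => (f n.+1 w - f n w) + (f n w - f 0%N w)).
  by apply/funext => w; rewrite addrA subrK.
apply: le_trans (absintD _ _ _ _) _ => //; do ?exact: measurable_funB.
apply: (le_trans (leeD (h n) IH)); rewrite -EFinD lee_fin -mulrDr exprS invfM.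
by rewrite le_eqVlt; apply/orP; left; apply/eqP; congr (_ * _); field.
Qed.

(** Fatou's lemma applied to the bounds of [absint_telescope]. *)
Lemma absint_limit f g (c : R) : (forall n, measurable_fun setT (f n)) ->
  (forall w, f ^~ w @ \oo --> g w) ->
  (forall n,
    absint P setT (fun w => f n.+1 w - f n w)%R <= (c * 2 ^- n)%:E)%E ->
  (absint P setT (fun w => g w - f 0%N w)%R <= (c * 2)%:E)%E.
Proof.
move=> mf fg h.
have c0 : 0 <= c.
  have := le_trans (absint_ge0 _ _ _) (h 0%N).
  by rewrite expr0 invr1 mulr1 lee_fin.
have gE w :
    (`|g w - f 0%N w|%:E = limn_einf (fun n => `|f n w - f 0%N w|%:E))%E.
  rewrite is_cvg_limn_einfE; [apply/esym/cvg_lim => //|];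
    last apply/cvg_ex; last eexists;
  by apply: cvg_EFin; [exact: nearW|apply: cvg_norm; apply: cvgB;
    [exact: fg|exact: cvg_cst]].
rewrite /absint; under eq_integral do rewrite gE.
apply: le_trans (fatou _ _ _ _) _ => //.
- by move=> n; apply: measurable_EFin_norm; exact: measurable_funB.
rewrite limn_einf_lim; apply: lime_le; first exact: is_cvg_einfs.
apply: nearW => n; apply: ge_ereal_inf.
exists (absint P setT (fun w => f n w - f 0%N w)).
  by exists n => /=.
apply: (le_trans (absint_telescope mf h n)); rewrite lee_fin ler_wpM2l//.
by rewrite gerBl mulr_ge0// invr_ge0 exprn_ge0.
Qed.

(** The sum S of the |f_(k+1) - f_k| is integrable, so f_n converges pointwise
    on the set {S < +oo}, which has full measure and belongs to G. Replacing
    f_n by 0 off this set makes the limit exist everywhere and G-measurable. *)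
Lemma L1_complete G f : sub_sigma G -> (forall n, measurable_wrt G (f n)) ->
  (forall n, absint P setT (fun w => f n.+1 w - f n w)%R <= (2 ^- n)%:E)%E ->
  exists g, measurable_wrt G g /\
    forall n, (absint P setT (fun w => g w - f n w)%R <= (2 ^- n * 2)%:E)%E.
Proof.
move=> hG wf h.
have mf n : measurable_fun setT (f n) by exact (measurable_wrt_fun hG (wf n)).
pose u k w : \bar R := `|f k.+1 w - f k w|%:E.
pose S w := (\sum_(k <oo) u k w)%E.
have u0 k w : (0 <= u k w)%E by rewrite lee_fin.
have mSG : measurable_fun [set: g_sigma_algebraType G]
    (S : g_sigma_algebraType G -> \bar R).
  apply: ge0_emeasurable_sum => [k w _ _|k _]; first exact: u0.
  apply: measurable_EFin_norm.
  by apply: measurable_funB; exact/(measurable_wrtP hG).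
pose D := [set w | S w < +oo]%E.
have GD : G D.
  rewrite -(sub_sigma_measurableE hG) -[X in measurable X]setTI.
  exact: emeasurable_fun_infty_o.
have aeD : {ae P, forall w, D w}.
  have mS : measurable_fun setT S.
    apply: ge0_emeasurable_sum => [k w _ _|k _]; first exact: u0.
    apply: measurable_EFin_norm.
    exact: measurable_funB.
  have S0 w : (0 <= S w)%E by apply: nneseries_ge0.
  have iS : P.-integrable setT S.
    apply/integrableP; split => //.
    under eq_integral do rewrite gee0_abs//.
    rewrite integral_nneseries//; last first.
      by move=> k; apply: measurable_EFin_norm; exact: measurable_funB.
    apply: (@le_lt_trans _ _ 2%:E); last exact: ltry.
    apply: lime_le.
      by apply: is_cvg_nneseries => k _ _; exact: absint_ge0.
    apply: nearW => n; apply: (@le_trans _ _ (2 - 2 * 2 ^- n)%:E); last first.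
      by rewrite lee_fin gerBl mulr_ge0// invr_ge0 exprn_ge0.
    elim: n => [|n IH]; first by rewrite big_geq// expr0 invr1 mulr1 subrr.
    rewrite big_nat_recr//=; apply: (le_trans (leeD IH (h n))).
    rewrite -EFinD lee_fin exprS invfM le_eqVlt; apply/orP; left; apply/eqP.
    by field.
  have := integrable_ae measurableT iS; apply: filterS => w /(_ I).
  by rewrite /D /= ge0_fin_numE.
have cvgD w : D w -> cvgn (f ^~ w).
  move=> Dw; have : cvgn (series (telescope (f ^~ w))).
    apply: normed_cvg; apply: nondecreasing_is_cvgn.
      by apply: nondecreasing_series => k _ _ /=.
    exists (fine (S w)) => _ [n _ <-].
    rewrite -lee_fin fineK ?ge0_fin_numE ?nneseries_ge0//.
    rewrite /series /= -sumEFin.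
    exact: (@nneseries_lim_ge _ (u ^~ w) xpredT 0%N n).
  rewrite telescopeK => /cvg_ex[l hl]; apply/cvg_ex; exists (l + f 0%N w).
  rewrite (_ : f ^~ w = (fun n => (f n w - f 0%N w) + f 0%N w)); last first.
    by apply/funext => n; rewrite subrK.
  by apply: cvgD; [exact: hl|exact: cvg_cst].
pose f' n := f n \_ D; pose g w := limn (f' ^~ w).
have f'D n w : D w -> f' n w = f n w by move=> Dw; rewrite /f' patchE mem_set.
have f'g w : f' ^~ w @ \oo --> g w.
  have [Dw|Dw] := pselect (D w).
    have -> : f' ^~ w = f ^~ w by apply/funext => n; rewrite f'D.
    rewrite /g (_ : f' ^~ w = f ^~ w); first exact: cvgD.
    by apply/funext => n; rewrite f'D.
  have -> : f' ^~ w = cst 0 by apply/funext => n; rewrite /f' patchE memNset.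
  rewrite /g (_ : f' ^~ w = cst 0) ?lim_cst//; first exact: cvg_cst.
  by apply/funext => n; rewrite /f' patchE memNset.
have wf' n : measurable_wrt G (f' n).
  apply/(measurable_wrtP hG); apply/measurable_restrict => //.
    by rewrite (sub_sigma_measurableE hG).
  by apply: measurable_funTS; exact/(measurable_wrtP hG).
have wg : measurable_wrt G g.
  apply/(measurable_wrtP hG).
  apply: (@measurable_fun_cvg _ (g_sigma_algebraType G) _ setT f') => [m|w _].
    exact/(measurable_wrtP hG).
  exact: f'g.
exists g; split => // n.
have mf' k : measurable_fun setT (f' k).
  by exact (measurable_wrt_fun hG (wf' k)).
have mg : measurable_fun setT g by exact (measurable_wrt_fun hG wg).
rewrite (@absint_ae _ _ _ _ _ _ (fun w => g w - f' n w))//; last first.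
- by apply: filterS aeD => w Dw; rewrite f'D.
- exact: measurable_funB.
- exact: measurable_funB.
apply: (@absint_limit (fun k => f' (k + n)%N)) => //.
- by move=> w; rewrite (cvg_shiftn n (f' ^~ w)); exact: f'g.
- move=> k; rewrite (@absint_ae _ _ _ _ _ _
    (fun w => f (k + n).+1 w - f (k + n)%N w))//.
  + by rewrite -invfM -exprD addnC; exact: h.
  + by apply: measurable_funB.
  + by apply: measurable_funB.
  + by apply: filterS aeD => w Dw; rewrite !f'D.
Qed.

End L1_completeness.

(** * Uniform integrability as approximation by bounded functions *)

Section uniform_integrability.
Context {R : realType} {dT : measure_display} {T : measurableType dT}.
Variable P : probability T R.
Implicit Types (f g Y Z : T -> R).

Lemma ge0_cvge0P {I : Type} (F : set_system I) {FF : Filter F}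
    (f : I -> \bar R) :
  (forall i, 0 <= f i)%E ->
  f @ F --> 0%E <-> forall e : R, 0 < e -> \forall i \near F, (f i <= e%:E)%E.
Proof.
move=> f0; split=> [/fine_cvgP[ffin /cvgrPdist_le h] e e0|h].
  have := h e e0; apply: filterS2 ffin => i fi; rewrite sub0r normrN => hi.
  by rewrite -(fineK fi) lee_fin (le_trans (ler_norm _)).
have ffin : \forall i \near F, f i \is a fin_num.
  apply: filterS (h 1 ltr01) => i fi.
  by rewrite ge0_fin_numE// (le_lt_trans fi) ?ltry.
apply/fine_cvgP; split => //; apply/cvgrPdist_le => e e0.
apply: filterS2 ffin (h e e0) => i fi hi.
rewrite sub0r normrN ger0_norm ?fine_ge0//.
by rewrite -lee_fin (fineK fi).
Qed.

Definition bounded_approx (a e : R) Y := exists g,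
  [/\ measurable_fun setT g, forall w, `|g w| <= a &
      (absint P setT (fun w => Y w - g w)%R <= e%:E)%E].

(** The bound a depends on the precision e but not on the index i. *)
Definition L1_approximable {I : Type} (Y : I -> T -> R) :=
  forall e : R, 0 < e -> exists a : R, forall i, bounded_approx a e (Y i).

Lemma bounded_approxW a a' e Y : a <= a' -> bounded_approx a e Y ->
  bounded_approx a' e Y.
Proof.
by move=> aa' [g [mg ga Yg]]; exists g; split => // w; exact: le_trans aa'.
Qed.

Lemma bounded_approx_perturb a e e' Y Y' : measurable_fun setT Y ->
  measurable_fun setT Y' ->
  (absint P setT (fun w => Y' w - Y w)%R <= e'%:E)%E ->
  bounded_approx a e Y -> bounded_approx a (e' + e) Y'.
Proof.
move=> mY mY' YY' [g [mg ga Yg]]; exists g; split => //.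
rewrite (_ : (fun w => _) = fun w => (Y' w - Y w) + (Y w - g w)); last first.
  by apply/funext => w; rewrite addrA subrK.
rewrite EFinD; apply: (le_trans (absintD _ _ _ _)) => //.
- exact: measurable_funB.
- exact: measurable_funB.
- exact: leeD.
Qed.

Lemma bounded_approx_integrable a e Y : measurable_fun setT Y ->
  bounded_approx a e Y -> (absint P setT Y < +oo)%E.
Proof.
move=> mY [g [mg ga Yg]].
rewrite (_ : Y = fun w => (Y w - g w) + g w); last first.
  by apply/funext => w; rewrite subrK.
apply: (le_lt_trans (absintD _ _ _ _)) => //; first exact: measurable_funB.
apply: lte_add_pinfty; first exact: le_lt_trans Yg (ltry _).
apply: (@le_lt_trans _ _ (absint P setT (cst a))).
  by apply: le_absint => // w _ /=; exact: le_trans (ga w) (ler_norm _).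
rewrite (_ : absint _ _ _ = \int[P]_(w in setT) (cst `|a|%:E w))%E//.
by rewrite integral_cst//= probability_setT mule1 ltry.
Qed.

(** Truncation at level n, by dominated convergence. *)
Lemma integrable_bounded_approx Y (e : R) : measurable_fun setT Y ->
  (absint P setT Y < +oo)%E -> 0 < e -> exists a, bounded_approx a e Y.
Proof.
move=> mY Yoo e0.
pose g n w := if `|Y w| <= n%:R then Y w else 0.
have mg n : measurable_fun setT (g n).
  apply: measurable_fun_ifT => //.
  by apply: measurable_fun_ler => //; exact: measurableT_comp.
have iY : P.-integrable setT (fun w => `|Y w|%:E).
  apply/integrableP; split; first exact: measurable_EFin_norm.
  by under eq_integral do rewrite /= normr_id.
have : (\int[P]_(w in setT) `|Y w - g n w|%:E)%E @[n --> \oo] -->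
    (\int[P]_(w in setT) (cst 0 w))%E.
  apply: (@dominated_cvg _ _ _ _ _ measurableT _ _ (fun w => `|Y w|%:E)) => //.
  - by move=> n; apply: measurable_EFin_norm; exact: measurable_funB.
  - move=> w _; apply/ge0_cvge0P => [n|d d0]; first by rewrite lee_fin.
    exists (Num.truncn `|Y w|).+1 => //= n /= hn.
    have Yn : `|Y w| <= n%:R.
      by apply: (le_trans (ltW (truncnS_gt _))); rewrite ler_nat.
    by rewrite /g Yn subrr normr0 lee_fin ltW.
  - move=> n w _; rewrite /= normr_id lee_fin /g.
    by case: ifPn => _; rewrite ?subrr ?normr0 ?subr0.
rewrite integral0 => /ge0_cvge0P h.
have [n hn] := filter_ex (h (fun n => absint_ge0 _ _ _) e e0).
exists n%:R, (g n); split => // w.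
by rewrite /g; case: ifPn => //; rewrite normr0.
Qed.

(** E(g|G) approximates E(Y|G) as well as g approximates Y; it is bounded by a
    only almost everywhere, hence the clipping to [-a, a]. *)
Lemma bounded_approx_condexp G a e Y : sub_sigma G -> measurable_fun setT Y ->
  sigma_integrable P G Y -> bounded_approx a e Y ->
  bounded_approx a e (condexp P G Y).
Proof.
move=> hG mY sY [g [mg ga Yg]].
have a0 : 0 <= a by exact: le_trans (normr_ge0 _) (ga point).
have sg : sigma_integrable P G g.
  apply: integrable_sigma_integrable => //.
  apply: (@bounded_approx_integrable a 0) => //; exists g; split => //.
  rewrite (_ : absint _ _ _ = 0%E)//.
  by rewrite /absint integral0_eq// => w _; rewrite subrr normr0.
have scst c : sigma_integrable P G (cst c).
  by apply: measurable_wrt_sigma_integrable => //; exact: measurable_wrt_cst.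
have wcst (c : R) : measurable_wrt G (cst c) by exact: measurable_wrt_cst.
have mc Z : measurable_fun setT (condexp P G Z) by exact: measurable_condexp.
have h1 : {ae P, forall w, condexp P G g w <= a}.
  have : {ae P, forall w, condexp P G g w <= condexp P G (cst a) w}.
    apply: le_condexp => //; apply: aeW => w /=.
    exact: le_trans (ler_norm _) (ga w).
  by apply: filterS2 (condexp_id P hG (wcst a)) => w ->.
have h2 : {ae P, forall w, - a <= condexp P G g w}.
  have : {ae P, forall w, condexp P G (cst (- a)) w <= condexp P G g w}.
    apply: le_condexp => //; apply: aeW => w /=.
    by have := ga w; rewrite ler_norml => /andP[].
  by apply: filterS2 (condexp_id P hG (wcst (- a))) => w ->.
pose g' w := Num.max (- a) (Num.min a (condexp P G g w)).
have mg' : measurable_fun setT g'.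
  by apply: measurable_maxr => //; exact: measurable_minr.
exists g'; split => //.
  move=> w; rewrite ler_norml /g' le_max lexx ge_max ge_min lexx/= andbT.
  by rewrite (le_trans _ a0) ?oppr_le0.
apply: le_trans Yg; rewrite (@absint_ae _ _ _ _ _ _
    (fun w => condexp P G Y w - condexp P G g w))//.
- exact: condexp_contraction.
- exact: measurable_funB.
- exact: measurable_funB.
- by apply: filterS2 h1 h2 => w /min_idPr e1 /max_idPr e2; rewrite /g' e1 e2.
Qed.

(** One direction truncates Y at level c. Conversely, if |g| <= a then
    |Y| <= 2 |Y - g| wherever |Y| >= 2 a. The index type must be inhabited:
    the supremum over an empty family is -oo, which does not tend to 0. *)
Lemma uniformly_integrableP {I : Type} (Y : I -> T -> R) : inhabited I ->
  (forall i, measurable_fun setT (Y i)) ->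
  uniformly_integrable P Y <-> L1_approximable Y.
Proof.
move=> [i0] mY; rewrite /uniformly_integrable.
pose tail c i := (\int[P]_(w in [set w | (c <= `|Y i w|)%R]) (`|Y i w|%R)%:E)%E.
have tail0 c i : (0 <= tail c i)%E by exact: absint_ge0.
have sup0 c : (0 <= ereal_sup (range (tail c)))%E.
  by apply: (le_trans (tail0 c i0)); apply: ereal_sup_ubound; exists i0.
have mtail c i : measurable [set w | c <= `|Y i w|].
  rewrite -[X in measurable X]setTI; apply: measurable_fun_le => //.
  exact: measurableT_comp.
split=> [/ge0_cvge0P h e e0|h].
  have [c [c0 hc]] : exists c : R, 0 < c /\
      (ereal_sup (range (tail c)) <= e%:E)%E.
    have := h sup0 e e0.
    move=> [M [Mr hM]]; exists (Num.max M 0 + 1); split.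
      by rewrite ltr_pwDr// le_max lexx orbT.
    by apply: hM; rewrite ltr_pwDr// le_max lexx.
  exists c => i; exists (fun w => if c <= `|Y i w| then 0 else Y i w); split.
  - apply: measurable_fun_ifT => //; apply: measurable_fun_ler => //.
    exact: measurableT_comp.
  - by move=> w; case: (leP c `|Y i w|) => [_|/ltW//]; rewrite normr0 ltW.
  - apply: le_trans hc; apply: (@le_trans _ _ (tail c i)); last first.
      by apply: ereal_sup_ubound; exists i.
    rewrite /tail integral_mkcond; apply: ge0_le_integral => //.
    + apply: measurable_EFin_norm; apply: measurable_funB => //.
      apply: measurable_fun_ifT => //; apply: measurable_fun_ler => //.
      exact: measurableT_comp.
    + by apply/measurable_restrict => //; apply: measurable_EFin_norm.
    + move=> w _; rewrite patchE; case: (leP c `|Y i w|) => cY.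
        by rewrite mem_set// subr0.
      by rewrite memNset ?subrr ?normr0//= => /(lt_le_trans cY); rewrite ltxx.
apply/ge0_cvge0P => // e e0.
have e20 : 0 < e / 2 by rewrite divr_gt0.
have [a ha] := h _ e20.
exists (2 * a); split; first exact: num_real.
move=> c /ltW ac; apply: ge_ereal_sup => _ [i _ <-].
have [g [mg ga Yg]] := ha i.
have m1 : measurable_fun setT (fun w => 2 * (Y i w - g w)).
  by apply: measurable_funM => //; exact: measurable_funB.
apply: (@le_trans _ _
  (absint P [set w | c <= `|Y i w|] (fun w => 2 * (Y i w - g w)))).
  apply: le_absint => // w /= cY.
  rewrite normrM ger0_norm//.
  have h1 : `|Y i w| - `|g w| <= `|Y i w - g w| by exact: lerB_dist.
  have h2 := ga w; lra.
apply: (@le_trans _ _ (absint P setT (fun w => 2 * (Y i w - g w)))).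
  exact: absint_subset.
rewrite (_ : e = 2 * (e / 2)); last by field.
rewrite EFinM /absint.
under eq_integral do rewrite normrM (ger0_norm (ler0n _ 2)) EFinM.
rewrite ge0_integralZl//; first exact: lee_wpmul2l.
by apply: measurable_EFin_norm; exact: measurable_funB.
Qed.

(** Far out, an approximation of Y serves for Y'; each of the finitely many
    remaining Y' is integrable, so it has an approximation of its own. *)
Lemma L1_approximable_perturb (Y Y' : nat -> T -> R) :
  (forall n, measurable_fun setT (Y n)) ->
  (forall n, measurable_fun setT (Y' n)) ->
  (forall n, absint P setT (fun w => Y' n w - Y n w)%R < +oo)%E ->
  (forall e : R, 0 < e -> exists N, forall n, (N <= n)%N ->
     (absint P setT (fun w => Y' n w - Y n w)%R <= e%:E)%E) ->
  L1_approximable Y -> L1_approximable Y'.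
Proof.
move=> mY mY' dfin dlim hY e e0.
have e20 : 0 < e / 2 by rewrite divr_gt0.
have [a ha] := hY _ e20; have [N hN] := dlim _ e20.
have /choice[b hb] n : exists b, bounded_approx b e (Y' n).
  apply: integrable_bounded_approx => //.
  rewrite (_ : Y' n = fun w => (Y' n w - Y n w) + Y n w); last first.
    by apply/funext => w; rewrite subrK.
  apply: (le_lt_trans (absintD _ _ _ _)) => //; first exact: measurable_funB.
  by apply: lte_add_pinfty => //; exact: bounded_approx_integrable (ha n).
exists (Num.max a (\sum_(n < N) `|b n|)) => n.
have [Nn|nN] := leqP N n.
  apply: (@bounded_approxW a); first by rewrite le_max lexx.
  by rewrite [e]splitr; apply: bounded_approx_perturb (ha n) => //; exact: hN.
apply: bounded_approxW (hb n); rewrite le_max; apply/orP; right.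
rewrite (bigD1 (Ordinal nN))//=; apply: (le_trans (ler_norm _)).
by rewrite lerDl sumr_ge0.
Qed.

End uniform_integrability.

(** * Quasi-martingales *)

Section quasi_martingales.
Context {R : realType} {dT : measure_display} {T : measurableType dT}.
Variable P : probability T R.
Context {dD : Order.disp_t} {Delta : orderType dD}.
Variable F : Delta -> set_system T.
Hypothesis hF : complete_filtration P F.
Implicit Types X Y M B : Delta -> T -> R.

Lemma filtration_sub_sigma t : sub_sigma (F t).
Proof. by case: hF => _ /(_ t)[]. Qed.
Let hS := filtration_sub_sigma.

Lemma filtration_le s t : (s <= t)%O -> F s `<=` F t.
Proof. by case: hF => _ _; apply. Qed.

Lemma adapted_measurable X : adapted F X -> forall t, measurable_fun setT (X t).
Proof. by move=> aX t; exact (measurable_wrt_fun (hS t) (aX t)). Qed.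

Lemma condexps_existP X : adapted F X -> condexps_exist P F X <->
  forall s t, (s <= t)%O -> sigma_integrable P (F s) (X t).
Proof.
move=> aX; split=> h s t /h.
  by move/(has_condexpP P (hS s) (adapted_measurable aX t)).
by move=> st; apply/(has_condexpP P (hS s) (adapted_measurable aX t)).
Qed.

Definition expected_drop X s t (w : T) := X s w - condexp P (F s) (X t) w.

Lemma measurable_expected_drop X : adapted F X ->
  forall s t, measurable_fun setT (expected_drop X s t).
Proof.
move=> aX s t; apply: measurable_funB; first exact: adapted_measurable.
exact: (measurable_condexp P (hS s)).
Qed.

Lemma expectation_dvariation d X : adapted F X ->
  ('E_P[dvariation P F d X] =
   \sum_(p <- steps d) absint P setT (expected_drop X p.1 p.2))%E.
Proof.
move=> aX; rewrite unlock /dvariation.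
under eq_integral do rewrite -sumEFin.
rewrite ge0_integral_sum// => p.
by apply: measurable_EFin_norm; exact: measurable_expected_drop.
Qed.

Lemma steps_le (d : {fset Delta}) p : p \in steps d -> (p.1 <= p.2)%O.
Proof.
rewrite /steps; have : sorted <=%O (sort <=%O (enum_fset d)).
  by apply: sort_sorted; exact: le_total.
case: (sort _ _) => // x l /=; elim: l x => // y l IH x /= /andP[xy /IH{}IH].
by rewrite inE => /orP[/eqP-> //|]; exact: IH.
Qed.

Lemma eq_qnorm X Y : adapted F X -> adapted F Y ->
  (forall s t, (s <= t)%O ->
    {ae P, forall w, expected_drop X s t w = expected_drop Y s t w}) ->
  qnorm P F X = qnorm P F Y.
Proof.
move=> aX aY XY.
suff h d : 'E_P[dvariation P F d X]%E = 'E_P[dvariation P F d Y]%E.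
  by rewrite /qnorm (funext h).
rewrite (expectation_dvariation d aX) (expectation_dvariation d aY).
apply: eq_big_seq => p /steps_le/XY h.
by apply: absint_ae => //; exact: measurable_expected_drop.
Qed.

(** Every finite chain arises from a finite set, so that sums over chains, which
    are easier to extend by new points, can be compared with the norm. *)
Lemma steps_sorted x (l : seq Delta) : path <%O x l ->
  exists d : {fset Delta}, steps d = zip (x :: l) l.
Proof.
move=> xl; exists [fset y in x :: l]%fset; rewrite /steps.
suff -> : sort <=%O (enum_fset [fset y in x :: l]%fset) = x :: l by [].
have sxl : sorted <%O (x :: l) by [].
apply: (sorted_eq le_trans le_anti).
- by apply: sort_sorted; exact: le_total.
- by rewrite lt_sorted_uniq_le in sxl; case/andP: sxl.
rewrite perm_sort; apply: uniq_perm.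
- exact: fset_uniq.
- by rewrite lt_sorted_uniq_le in sxl; case/andP: sxl.
by move=> y; rewrite !inE.
Qed.

Lemma chain_le_qnorm X x l : adapted F X -> path <%O x l ->
  (\sum_(p <- zip (x :: l) l) absint P setT (expected_drop X p.1 p.2) <=
   qnorm P F X)%E.
Proof.
move=> aX /steps_sorted[d dE]; rewrite -dE -expectation_dvariation//.
by apply: ereal_sup_ubound; exists d.
Qed.

Lemma zip_cat_path (x : Delta) l1 l2 : zip (x :: l1 ++ l2) (l1 ++ l2) =
  zip (x :: l1) l1 ++ zip (last x l1 :: l2) l2.
Proof. by elim: l1 x => //= y l1 IH x; rewrite IH. Qed.

Lemma expected_drop_diag X t : adapted F X ->
  absint P setT (expected_drop X t t) = 0%E.
Proof.
move=> aX; rewrite (@absint_ae _ _ _ _ _ _ (cst 0))//.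
- by rewrite /absint integral0_eq// => w _; rewrite normr0.
- exact: measurable_expected_drop.
- apply: filterS (condexp_id P (hS t) (aX t)) => w e.
  by rewrite /expected_drop e subrr.
Qed.

Lemma expected_drop_fin X s t : quasi_martingale P F X -> (s <= t)%O ->
  (absint P setT (expected_drop X s t) < +oo)%E.
Proof.
move=> [aX _ Xoo]; rewrite le_eqVlt => /orP[/eqP->|st].
  by rewrite expected_drop_diag.
apply: le_lt_trans Xoo; apply: le_trans (@chain_le_qnorm X s [:: t] aX _).
  by rewrite /= big_seq1.
by rewrite /= st.
Qed.

(** Take a chain whose total drop is within e of the supremum. Appending s and t
    beyond its last point adds at least the drop from s to t, and the total
    still does not exceed the supremum. *)
Lemma expected_drop_cauchy X : inhabited Delta -> quasi_martingale P F X ->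
  forall e : R, 0 < e -> exists t0, forall s t, (t0 <= s)%O -> (s <= t)%O ->
    (absint P setT (expected_drop X s t) <= e%:E)%E.
Proof.
move=> [x0] [aX _ Xoo] e e0.
have c0 s t : (0 <= absint P setT (expected_drop X s t))%E by exact: absint_ge0.
have q0 : (0 <= qnorm P F X)%E.
  by have := @chain_le_qnorm X x0 [::] aX isT; rewrite /= big_nil.
have qfin : qnorm P F X \is a fin_num by rewrite ge0_fin_numE.
have [x [l [xl hl]]] : exists x l, path <%O x l /\
    (qnorm P F X - e%:E <
     \sum_(p <- zip (x :: l) l) absint P setT (expected_drop X p.1 p.2))%E.
  have : (qnorm P F X - e%:E < qnorm P F X)%E.
    by rewrite lteBlDr// lteDl// lte_fin.
  move=> /ereal_sup_gt[_ [d _ <-]]; rewrite expectation_dvariation// /steps.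
  have : sorted <%O (sort <=%O (enum_fset d)).
    rewrite lt_sorted_uniq_le sort_uniq fset_uniq/=.
    by apply: sort_sorted; exact: le_total.
  case: (sort _ _) => [_ h|x l xl h]; last by exists x, l.
  by exists x0, [::]; split => //; rewrite /= big_nil in h *.
exists (last x l) => s t ls; rewrite le_eqVlt => /orP[/eqP->|st].
  by rewrite expected_drop_diag// lee_fin ltW.
(* A chain is strictly increasing, so s is appended only when it is new. *)
pose l2 := if s == last x l then [:: t] else [:: s; t].
have xl2 : path <%O x (l ++ l2).
  rewrite cat_path xl /l2 /=; case: eqVneq => [<-|ne] /=; first by rewrite st.
  by rewrite st andbT lt_neqAle ls eq_sym ne.
have := chain_le_qnorm aX xl2; rewrite zip_cat_path big_cat/=.
set S := (\sum_(p <- zip (x :: l) l) _)%E in hl *.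
have S0 : (0 <= S)%E by apply: sume_ge0 => p _.
have cl2 : (absint P setT (expected_drop X s t) <=
    \sum_(p <- zip (last x l :: l2) l2)
      absint P setT (expected_drop X p.1 p.2))%E.
  rewrite /l2; case: eqVneq => [->|_] /=; first by rewrite big_seq1.
  by rewrite big_cons big_seq1 /= leeDr.
move=> h; have {}h := le_trans (leeD2l S cl2) h.
have Sfin : S \is a fin_num.
  rewrite ge0_fin_numE//; apply: le_lt_trans Xoo; apply: le_trans h.
  by rewrite leeDl.
suff : (S + absint P setT (expected_drop X s t) <= S + e%:E)%E.
  by rewrite leeD2lE.
by apply: (le_trans h); rewrite -leeBlDr//; exact: ltW.
Qed.

(** Convergence to 0 in L1 along the directed set Delta. *)
Definition vanishing X := forall e : R, 0 < e -> exists t0, forall v,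
  (t0 <= v)%O -> (absint P setT (X v) <= e%:E)%E.

(** If the L1 norms do not vanish at infinity, then beyond each u_n there is
    some v_n where the norm exceeds e, and this sequence v violates the
    condition on u. *)
Lemma quasi_potentialP X :
  quasi_potential P F X <-> quasi_martingale P F X /\ vanishing X.
Proof.
have EE v : ('E_P[fun w => `|X v w|%R] = absint P setT (X v))%E.
  by rewrite unlock.
split=> -[qX h]; split => //.
  move: h => [u h] e e0; apply: contrapT => /forallNP hn.
  have /choice[v hv] n : exists v,
      (u n <= v)%O /\ ~ (absint P setT (X v) <= e%:E)%E.
    have := hn (u n) => /existsNP[v /not_implyP[uv ve]].
    by exists v.
  have := h v (fun n => (hv n).1).
  move/(ge0_cvge0P (fun n => _)) => h'.
  have [|n] := filter_ex (h' _ e e0).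
    by move=> n; rewrite EE absint_ge0.
  by rewrite EE; exact: (hv n).2.
have /choice[u hu] (n : nat) : exists t0, forall v, (t0 <= v)%O ->
    (absint P setT (X v) <= (n.+1%:R^-1)%:E)%E.
  by apply: h; rewrite invr_gt0.
exists u => v uv; apply/ge0_cvge0P => [n|e e0]; first by rewrite EE absint_ge0.
near=> n; rewrite EE; apply: (le_trans (hu n _ (uv n))); rewrite lee_fin ltW//.
near: n; exact: near_infty_natSinv_lt (PosNum e0).
Unshelve. all: by end_near. Qed.

End quasi_martingales.

(** * The Riesz decomposition *)

Section riesz.
Context {R : realType} {dT : measure_display} {T : measurableType dT}.
Variable P : probability T R.
Context {dD : Order.disp_t} {Delta : orderType dD}.
Variable F : Delta -> set_system T.
Hypothesis hF : complete_filtration P F.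
Implicit Types X Y M B : Delta -> T -> R.
Let hS := filtration_sub_sigma hF.
Let hle := filtration_le hF.
Local Notation L1 := (absint P setT).
Local Notation E_ s Y := (condexp P (F s) Y).

Lemma measurable_condexpF s (Y : T -> R) :
  measurable_fun setT (E_ s Y).
Proof. exact: (measurable_condexp P (hS s)). Qed.

(** E_s M_t = M_s cancels against M_s. That E_s X_t exists follows from the
    sigma-integrability of both terms. *)
Lemma expected_drop_riesz X M B :
  adapted F X -> martingale P F M -> adapted F B ->
  condexps_exist P F B -> modification P X (fun t w => M t w + B t w) ->
  condexps_exist P F X /\ forall s t, (s <= t)%O ->
    {ae P, forall w, expected_drop P F X s t w = expected_drop P F B s t w}.
Proof.
move=> aX [aM eM MM] aB eB XMB.
have mX := adapted_measurable hF aX; have mM := adapted_measurable hF aM.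
have mB := adapted_measurable hF aB.
have {}eM := (condexps_existP hF aM).1 eM.
have {}eB := (condexps_existP hF aB).1 eB.
have eX s t : (s <= t)%O -> sigma_integrable P (F s) (X t).
  move=> st.
  apply: (@sigma_integrable_ae _ _ _ _ _ (fun w => M t w + B t w)) => //.
  - exact: measurable_funD.
  - by apply: filterS (XMB t) => w ->.
  - by apply: (sigma_integrableD (hS s));
      [exact: mM|exact: mB|exact: eM|exact: eB].
split; first exact/(condexps_existP hF aX).
move=> s t st.
have h1 : {ae P, forall w, E_ s (M t) w = E_ s (fun w => X t w - B t w) w}.
  apply: (condexp_ae (hS s)) => //; [exact: measurable_funB|exact: eM|].
  by apply: filterS (XMB t) => w ->; rewrite addrK.
have h2 := condexpB (hS s) (mX t) (mB t) (eX s t st) (eB s t st).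
have h3 := MM s t st; have h4 := XMB s.
apply: filterS2 (filterI h1 h2) (filterI h3 h4) => w [e1 e2] [e3 e4].
by rewrite /expected_drop e4 -e3 e1 e2 addrAC; ring.
Qed.

(** E_s X_b is the conditional expectation given F_s of E_a X_b, so the
    contraction property compares X_a with E_a X_b. *)
Lemma condexp_dist X s a b : adapted F X -> condexps_exist P F X ->
  (s <= a)%O -> (a <= b)%O ->
  (L1 (fun w => E_ s (X a) w - E_ s (X b) w)%R <=
   L1 (expected_drop P F X a b))%E.
Proof.
move=> aX eX sa ab; have {}eX := (condexps_existP hF aX).1 eX.
have mX := adapted_measurable hF aX.
have sb := le_trans sa ab.
have [sE tower] := condexp_tower (hS s) (hS a) (hle sa) (mX b) (eX s b sb).
rewrite (@absint_ae _ _ _ _ _ _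
  (fun w => E_ s (X a) w - E_ s (E_ a (X b)) w))//.
- apply: (condexp_contraction (hS s)) => //; last exact: eX.
  exact: measurable_condexpF.
- by apply: measurable_funB; exact: measurable_condexpF.
- by apply: measurable_funB; exact: measurable_condexpF.
- by apply: filterS tower => w ->.
Qed.

(** M_s is the limit of E_s X_v as v grows, uniformly in s; the uniformity is
    what allows s = v, hence X_v - M_v -> 0. *)
Definition limit_of_condexps X M := forall e : R, 0 < e -> exists t0,
  forall s v, (s <= v)%O -> (t0 <= v)%O ->
    (L1 (fun w => M s w - E_ s (X v) w)%R <= e%:E)%E.

(** Delta may have no countable cofinal subset. A sequence tau suffices
    nevertheless: beyond tau_n all drops are at most 2^-n, so every sequence of
    points beyond the tau_n leads to the same limit. *)
Lemma limit_of_condexps_exists X : inhabited Delta -> quasi_martingale P F X ->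
  exists M, adapted F M /\ limit_of_condexps X M.
Proof.
move=> hD qX; have [aX eX _] := qX; have mX := adapted_measurable hF aX.
have /choice[t ht] (n : nat) : exists t0, forall s t,
    (t0 <= s)%O -> (s <= t)%O ->
    (L1 (expected_drop P F X s t) <= (2 ^- n)%:E)%E.
  by apply: (expected_drop_cauchy hF hD qX); rewrite invr_gt0 exprn_gt0.
pose tau := fix tau n :=
  if n is m.+1 then Order.max (tau m) (t m.+1) else t 0%N.
have ttau n : (t n <= tau n)%O.
  by case: n => [|n] /=; rewrite ?le_max lexx ?orbT.
have tauS n : (tau n <= tau n.+1)%O by rewrite /= le_max lexx.
pose f s n := E_ s (X (Order.max s (tau n))).
have fE s n v : (s <= v)%O -> (tau n <= v)%O ->
    (L1 (fun w => f s n w - E_ s (X v) w)%R <= (2 ^- n)%:E)%E.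
  move=> sv nv; apply: (le_trans (condexp_dist _ _ _ _)) => //.
  - by rewrite le_max lexx.
  - by rewrite ge_max sv.
  - by apply: ht; rewrite ?ge_max ?sv// le_max ttau orbT.
have /choice[M hM] s : exists g, measurable_wrt (F s) g /\
    forall n, (L1 (fun w => g w - f s n w)%R <= (2 ^- n * 2)%:E)%E.
  apply: L1_complete; first exact: hS.
    by move=> n B; exact: (condexp_wrt (hS s)).
  move=> n; rewrite absint_sym; apply: fE; first by rewrite le_max lexx.
  by rewrite le_max tauS orbT.
exists M; split; first by move=> s; case: (hM s).
have mM s : measurable_fun setT (M s).
  by exact (measurable_wrt_fun (hS s) (hM s).1).
move=> e e0; pose n := (Num.truncn (3 / e)).+1.
(* 3 = 2 + 1: the distance from the limit to the n-th term is at most 2 * 2^-n,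
   and the drop beyond tau_n at most 2^-n. *)
have ne : 2 ^- n * 3 <= e.
  have h1 : 3 / e < n%:R by exact: truncnS_gt.
  have h2 : n%:R <= 2 ^+ n :> R by rewrite -natrX ler_nat ltnW// ltn_expl.
  have p0 : 0 < 2 ^+ n :> R by rewrite exprn_gt0.
  by rewrite mulrC ler_pdivrMr// -ler_pdivrMl// mulrC ltW// (lt_le_trans h1).
exists (tau n) => s v sv nv.
apply: (le_trans (absint_triangle P (mM s)
  (measurable_condexpF s (X (Order.max s (tau n))))
  (measurable_condexpF s (X v)))).
apply: (le_trans (leeD ((hM s).2 n) (fE s n v sv nv))).
rewrite -EFinD lee_fin; apply: le_trans ne.
by rewrite le_eqVlt; apply/orP; left; apply/eqP; ring.
Qed.

(** Both E_s M_t and M_s are close to E_s X_v for v large, the former because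
    E_s is a contraction and E_s E_t X_v = E_s X_v. *)
Lemma limit_of_condexps_martingale X M : adapted F X -> condexps_exist P F X ->
  adapted F M -> limit_of_condexps X M -> martingale P F M.
Proof.
move=> aX eX aM hM; have {}eX := (condexps_existP hF aX).1 eX.
have mX := adapted_measurable hF aX; have mM := adapted_measurable hF aM.
have mE := measurable_condexpF.
have eM s t : (s <= t)%O -> sigma_integrable P (F s) (M t).
  move=> st; have [t0 ht0] := hM 1 ltr01; pose v := Order.max t t0.
  have tv : (t <= v)%O by rewrite le_max lexx.
  have t0v : (t0 <= v)%O by rewrite le_max lexx orbT.
  have h := ht0 t v tv t0v.
  have [sE _] := condexp_tower (hS s) (hS t) (hle st) (mX v)
    (eX s v (le_trans st tv)).
  rewrite (_ : M t = fun w => (M t w - E_ t (X v) w) + E_ t (X v) w); last first.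
    by apply/funext => w; rewrite subrK.
  apply: (sigma_integrableD (hS s)) => //; first exact: measurable_funB.
  apply: (integrable_sigma_integrable (hS s)).
  exact: le_lt_trans h (ltry _).
split => //; first exact/(condexps_existP hF aM).
move=> s t st.
suff : {ae P, forall w, E_ s (M t) w - M s w = 0}.
  by apply: filterS => w /eqP; rewrite subr_eq0 => /eqP.
apply: absint_small_ae; first exact: measurable_funB.
move=> e e0; have e20 : 0 < e / 2 by rewrite divr_gt0.
have [t0 ht0] := hM _ e20; pose v := Order.max t t0.
have tv : (t <= v)%O by rewrite le_max lexx.
have t0v : (t0 <= v)%O by rewrite le_max lexx orbT.
have sv := le_trans st tv.
have [sE tower] := condexp_tower (hS s) (hS t) (hle st) (mX v) (eX s v sv).
apply: (le_trans (absint_triangle P (mE s (M t)) (mE s (X v)) (mM s))).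
rewrite (splitr e) EFinD; apply: leeD; last first.
  by rewrite absint_sym; exact: ht0.
rewrite (@absint_ae _ _ _ _ _ _
  (fun w => E_ s (M t) w - E_ s (E_ t (X v)) w))//.
- apply: le_trans (ht0 t v tv t0v).
  by apply: (condexp_contraction (hS s)) => //; exact: eM.
- exact: measurable_funB.
- exact: measurable_funB.
- by apply: filterS tower => w ->.
Qed.

Lemma quasi_martingale_riesz X : inhabited Delta -> quasi_martingale P F X ->
  exists M B, riesz_decomposition P F X M B.
Proof.
move=> hD qX; have [aX eX Xoo] := qX.
have [M [aM hM]] := limit_of_condexps_exists hD qX.
have MM := limit_of_condexps_martingale aX eX aM hM.
have mX := adapted_measurable hF aX; have mM := adapted_measurable hF aM.
pose B t w := X t w - M t w; exists M, B.
have aB : adapted F B.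
  by move=> t; apply/(measurable_wrtP (hS t)); apply: measurable_funB;
    apply/(measurable_wrtP (hS t)).
have XMB : modification P X (fun t w => M t w + B t w).
  by move=> t; apply: aeW => w; rewrite /B addrC subrK.
have eB : condexps_exist P F B.
  apply/(condexps_existP hF aB) => s t st.
  apply: (sigma_integrableB (hS s)) => //.
    exact: ((condexps_existP hF aX).1 eX).
  by case: MM => _ eM _; exact: ((condexps_existP hF aM).1 eM).
have [_ inc] := expected_drop_riesz aX MM aB eB XMB.
split; [exact: MM| |exact: XMB].
apply/quasi_potentialP; split.
  by split; [exact: aB|exact: eB|rewrite -(eq_qnorm hF aX aB inc)].
move=> e /hM[t0 ht0]; exists t0 => v tv.
apply: le_trans (ht0 v v (lexx v) tv); rewrite absint_sym le_eqVlt.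
apply/orP; left; apply/eqP; apply: absint_ae => //.
- exact: measurable_funB.
- by apply: measurable_funB => //; exact: measurable_condexpF.
- by apply: filterS (condexp_id P (hS v) (aX v)) => w ->.
Qed.

Section decomposition.
Variables X M B : Delta -> T -> R.
Hypothesis aX : adapted F X.
Hypothesis XMB : riesz_decomposition P F X M B.

Lemma riesz_adapted : adapted F M /\ adapted F B.
Proof. by case: XMB => -[aM _ _] [[aB _ _] _] _. Qed.

Lemma riesz_expected_drop : condexps_exist P F X /\ forall s t, (s <= t)%O ->
  {ae P, forall w, expected_drop P F X s t w = expected_drop P F B s t w}.
Proof.
case: XMB => MM [[aB eB _] _] h.
exact: (expected_drop_riesz aX MM aB eB h).
Qed.

Lemma riesz_quasi_martingale : quasi_martingale P F X.
Proof.
have [eX inc] := riesz_expected_drop; have [_ aB] := riesz_adapted.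
by split => //; rewrite (eq_qnorm hF aX aB inc); case: XMB => _ [[]].
Qed.

(** M_s = E_s M_v and M_v - X_v = - B_v. *)
Lemma riesz_dist s v : (s <= v)%O ->
  (L1 (fun w => M s w - E_ s (X v) w)%R <= L1 (B v))%E.
Proof.
move=> sv; case: XMB => -[aM eM MM] _ h; have [_ aB] := riesz_adapted.
have [eX _] := riesz_expected_drop.
have mX := adapted_measurable hF aX; have mM := adapted_measurable hF aM.
have mB := adapted_measurable hF aB; have mE := measurable_condexpF.
rewrite (@absint_ae _ _ _ _ _ _ (fun w => E_ s (M v) w - E_ s (X v) w))//.
- apply: le_trans (condexp_contraction (hS s) _ _ _ _) _ => //.
  + exact: ((condexps_existP hF aM).1 eM).
  + exact: ((condexps_existP hF aX).1 eX).
  rewrite absint_sym le_eqVlt; apply/orP; left; apply/eqP.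
  apply: absint_ae => //.
    exact: measurable_funB.
  by apply: filterS (h v) => w ->; rewrite addrAC subrr add0r.
- exact: measurable_funB.
- exact: measurable_funB.
- by apply: filterS (MM s v sv) => w ->.
Qed.

Lemma riesz_limit_of_condexps : limit_of_condexps X M.
Proof.
have /quasi_potentialP[_ vB] : quasi_potential P F B by case: XMB.
move=> e /vB[t0 ht0]; exists t0 => s v sv tv.
exact: le_trans (riesz_dist sv) (ht0 v tv).
Qed.

End decomposition.

Lemma riesz_unique X M B M' B' : adapted F X -> riesz_decomposition P F X M B ->
  riesz_decomposition P F X M' B' -> modification P M M' /\ modification P B B'.
Proof.
move=> aX d d'.
have [aM aB] := riesz_adapted d; have [aM' aB'] := riesz_adapted d'.
have mM := adapted_measurable hF aM; have mM' := adapted_measurable hF aM'.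
have MM' : modification P M M'.
  move=> s; suff : {ae P, forall w, M s w - M' s w = 0}.
    by apply: filterS => w /eqP; rewrite subr_eq0 => /eqP.
  apply: absint_small_ae; first exact: measurable_funB.
  move=> e e0; have e20 : 0 < e / 2 by rewrite divr_gt0.
  have [t0 ht0] := riesz_limit_of_condexps aX d e20.
  have [t1 ht1] := riesz_limit_of_condexps aX d' e20.
  pose v := Order.max s (Order.max t0 t1).
  have sv : (s <= v)%O by rewrite le_max lexx.
  have t0v : (t0 <= v)%O by rewrite !le_max lexx !orbT.
  have t1v : (t1 <= v)%O by rewrite !le_max lexx !orbT.
  apply: (le_trans
    (absint_triangle P (mM s) (measurable_condexpF s (X v)) (mM' s))).
  rewrite (splitr e) EFinD; apply: leeD; first exact: ht0.
  by rewrite absint_sym; exact: ht1.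
split => // t; case: d => _ _ /(_ t) h; case: d' => _ _ /(_ t) h'.
apply: filterS2 (filterI h h') (MM' t) => w [-> e1] e2.
by move: e1; rewrite e2 => /addrI.
Qed.

(** B_s differs from E_s B_v by a term of finite norm, and B_v is integrable for
    v large. *)
Lemma quasi_potential_integrable B : quasi_potential P F B ->
  forall s, (L1 (B s) < +oo)%E.
Proof.
move=> /quasi_potentialP[qB vB] s; have [aB eB _] := qB.
have mB := adapted_measurable hF aB.
have [t0 ht0] := vB 1 ltr01; pose v := Order.max s t0.
have sv : (s <= v)%O by rewrite le_max lexx.
have t0v : (t0 <= v)%O by rewrite le_max lexx orbT.
rewrite (_ : B s = fun w => expected_drop P F B s v w + E_ s (B v) w); last first.
  by apply/funext => w; rewrite subrK.
have mi := measurable_expected_drop hF aB s v.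
apply: (le_lt_trans (absintD P measurableT mi (measurable_condexpF s _))).
apply: lte_add_pinfty; first exact: expected_drop_fin.
apply: le_lt_trans (absint_condexp (hS s) (mB v) _ _) _.
- exact: ((condexps_existP hF aB).1 eB).
- exact: (sub_sigmaT (hS s)).
- exact: le_lt_trans (ht0 v t0v) (ltry _).
Qed.

(** B_s - E_s B_v >= 0 converges to B_s in L1 as v grows. *)
Lemma quasi_potential_super_ge0 B : quasi_potential P F B ->
  supermartingale P F B -> positive_process P B.
Proof.
move=> /quasi_potentialP[qB vB] [aB eB sB] s.
have mB := adapted_measurable hF aB.
apply: ae_ge0_of_approx => // e /vB[t0 ht0]; pose v := Order.max s t0.
have sv : (s <= v)%O by rewrite le_max lexx.
have t0v : (t0 <= v)%O by rewrite le_max lexx orbT.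
exists (expected_drop P F B s v); split.
- exact: (measurable_expected_drop hF aB).
- by apply: filterS (sB s v sv) => w; rewrite /expected_drop subr_ge0.
rewrite (_ : (fun w => _) = E_ s (B v)); last first.
  by apply/funext => w; rewrite /expected_drop opprB addrC subrK.
apply: le_trans (absint_condexp (hS s) (mB v) _ _) _.
- exact: ((condexps_existP hF aB).1 eB).
- exact: (sub_sigmaT (hS s)).
- exact: ht0.
Qed.

Lemma supermartingale_potential X M B : adapted F X ->
  riesz_decomposition P F X M B -> supermartingale P F X <-> potential P F B.
Proof.
move=> aX d; have [eX inc] := riesz_expected_drop aX d.
have qB : quasi_potential P F B by case: d.
have [[aB eB _] _] := qB.
split=> [[_ _ sX]|[_ [[_ _ sB] _]]].
  have sB : supermartingale P F B.
    split => // s t st; apply: filterS2 (sX s t st) (inc s t st) => w.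
    by rewrite /expected_drop -subr_ge0 => + e; rewrite e subr_ge0.
  by split => //; split => //; exact: quasi_potential_super_ge0.
split => // s t st; apply: filterS2 (sB s t st) (inc s t st) => w.
by rewrite /expected_drop -subr_ge0 => + e; rewrite -e subr_ge0.
Qed.

(** M_s is the limit of the nonnegative E_s X_v. *)
Lemma positive_riesz_martingale X M B : adapted F X ->
  riesz_decomposition P F X M B -> positive_process P X -> positive_process P M.
Proof.
move=> aX d X0 s; have [eX _] := riesz_expected_drop aX d.
have [aM aB] := riesz_adapted d; have mX := adapted_measurable hF aX.
apply: ae_ge0_of_approx; first exact: (adapted_measurable hF aM).
move=> e e0; have [t0 ht0] := riesz_limit_of_condexps aX d e0.
pose v := Order.max s t0.
have sv : (s <= v)%O by rewrite le_max lexx.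
have t0v : (t0 <= v)%O by rewrite le_max lexx orbT.
exists (E_ s (X v)); split; [exact: measurable_condexpF| |exact: ht0].
have w0 : measurable_wrt (F s) (cst (0 : R)).
  by move=> C; exact: (measurable_wrt_cst (hS s)).
have : {ae P, forall w, E_ s (cst 0) w <= E_ s (X v) w}.
  apply: (le_condexp (hS s)) => //.
  - exact: (measurable_wrt_sigma_integrable P (hS s) w0).
  - exact: ((condexps_existP hF aX).1 eX).
by apply: filterS2 (condexp_id P (hS s) w0) => w ->.
Qed.

Lemma positive_supermartingale_potential X M B : adapted F X ->
  riesz_decomposition P F X M B ->
  positive_supermartingale P F X <-> potential P F B /\ positive_process P M.
Proof.
move=> aX d; have sXB := supermartingale_potential aX d.
split=> [[sX X0]|[pB M0]].
  by split; [exact/sXB|exact: positive_riesz_martingale d X0].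
split; first exact/sXB.
move=> t; case: pB => _ [_ /(_ t) B0]; case: d => _ _ /(_ t) XE.
by apply: filterS2 (filterI B0 (M0 t)) XE => w [b m] ->; rewrite addr_ge0.
Qed.

(** Every M_s is a conditional expectation of some M_(u_n), and conditional
    expectation preserves bounded approximation. *)
Lemma martingale_uniformly_integrable_cofinal M (u : nat -> Delta) :
  inhabited Delta -> martingale P F M -> (forall t, exists n, (t <= u n)%O) ->
  uniformly_integrable P M <-> uniformly_integrable P (fun n => M (u n)).
Proof.
move=> hD [aM eM MM] cu; have mM := adapted_measurable hF aM.
rewrite (uniformly_integrableP P hD)//.
rewrite (uniformly_integrableP P (inhabits 0%N))//.
split=> h e /h[a ha]; exists a; first by move=> n; exact: ha.
move=> s; have [n sn] := cu s.
have [g [mg ga Mg]] : bounded_approx P a e (E_ s (M (u n))).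
  apply: (bounded_approx_condexp (hS s)) => //.
  exact: ((condexps_existP hF aM).1 eM).
exists g; split => //; apply: le_trans Mg; rewrite le_eqVlt; apply/orP; left.
apply/eqP; apply: absint_ae => //.
- exact: measurable_funB.
- by apply: measurable_funB => //; exact: measurable_condexpF.
- by apply: filterS (MM s (u n) sn) => w ->.
Qed.

Lemma riesz_uniformly_integrable X M B (u : nat -> Delta) :
  inhabited Delta -> adapted F X -> riesz_decomposition P F X M B ->
  nondecreasing_seq u -> (forall t, exists n, (t <= u n)%O) ->
  uniformly_integrable P M <-> uniformly_integrable P (fun n => X (u n)).
Proof.
move=> hD aX d ndu cu; have [MM qB XMB] := d; have [aM aB] := riesz_adapted d.
have mX := adapted_measurable hF aX; have mM := adapted_measurable hF aM.
have mB := adapted_measurable hF aB.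
rewrite (martingale_uniformly_integrable_cofinal hD MM cu).
rewrite !(uniformly_integrableP P (inhabits 0%N))//.
have [_ vB] := (quasi_potentialP P F B).1 qB.
have BE t : L1 (fun w => X t w - M t w) = L1 (B t).
  apply: absint_ae => //; first exact: measurable_funB.
  by apply: filterS (XMB t) => w ->; rewrite addrAC subrr add0r.
have Boo n : (L1 (fun w => X (u n) w - M (u n) w)%R < +oo)%E.
  by rewrite BE; exact: quasi_potential_integrable.
have Blim e : 0 < e -> exists N, forall n, (N <= n)%N ->
    (L1 (fun w => X (u n) w - M (u n) w)%R <= e%:E)%E.
  move=> /vB[t0 ht0]; have [N t0N] := cu t0; exists N => n Nn.
  by rewrite BE; apply: ht0; exact: le_trans t0N (ndu _ _ Nn).
split; apply: L1_approximable_perturb => //.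
  by move=> n; rewrite absint_sym.
by move=> e /Blim[N hN]; exists N => n /hN; rewrite absint_sym.
Qed.

End riesz.

Theorem corollary2 (R : realType) (dT : measure_display)
    (T : measurableType dT) (P : probability T R)
    (dD : Order.disp_t) (Delta : orderType dD) (F : Delta -> set_system T)
    (LIM : ({fset Delta} -> R) -> R) (X : Delta -> T -> R)
    (Delta_neq0 : inhabited Delta)
    (hF : complete_filtration P F)
    (hLIM : banach_limit LIM)
    (hX : adapted F X) :
  (quasi_martingale P F X <-> exists M B, riesz_decomposition P F X M B) /\
  (forall M B M' B', riesz_decomposition P F X M B ->
     riesz_decomposition P F X M' B' ->
     modification P M M' /\ modification P B B') /\
  (forall M B, riesz_decomposition P F X M B ->
     (supermartingale P F X <-> potential P F B) /\
     (positive_supermartingale P F X <-> potential P F B /\ positive_process P M) /\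
     (forall (x : set (T * Delta) -> R) (dlo dup : nat -> Delta),
        corresponds P F LIM X x ->
        nonincreasing_seq dlo -> nondecreasing_seq dup ->
        ba_variation P x (strip (dlo n) (dup n)) @[n --> \oo] -->
          ereal_sup (range (fun p : Delta * Delta =>
            ba_variation P x (strip p.1 p.2))) ->
        (forall t, exists n, (t <= dup n)%O) ->
        (uniformly_integrable P M <->
         uniformly_integrable P (fun n : nat => X (dup n))))).
Proof.
split; [|split].
- split=> [qX|[M [B d]]].
    exact: (quasi_martingale_riesz hF Delta_neq0 qX).
  exact: (riesz_quasi_martingale hF hX d).
- by move=> M B M' B'; exact: (riesz_unique hF hX).
move=> M B d; split; [|split].
- exact: (supermartingale_potential hF hX d).
- exact: (positive_supermartingale_potential hF hX d).
move=> x dlo dup _ _ ndup _ cofinal_dup.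
exact: (riesz_uniformly_integrable hF Delta_neq0 hX d ndup cofinal_dup).
Qed.
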